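(* Let $n\ge 0$ and $0\le k\le n+1$. The algebra $\mathcal{B}_0(n,k)$ is isomorphic, as an algebra over $\mathbb{F}_2[U_1,\ldots,U_n]^{V(n,k)}$, to the quotient $\mathrm{Quiv}(\Gamma(n,k),\mathcal{R})$ of the path algebra (over $\mathbb{F}_2$) of the quiver $\Gamma(n,k)$ by the two-sided ideal generated by the set of relations $\mathcal{R}$.
   Context: Notation: $[a,b]=\{a,a+1,\ldots,b\}$. $V(n,k)$ is the set of $k$-element subsets $\mathbf{x}$ of $[0,n]$. For $\mathbf{x},\mathbf{y}\in V(n,k)$ and $1\le i\le n$ put $v_i(\mathbf{x},\mathbf{y})=|\mathbf{y}\cap[i,n]|-|\mathbf{x}\cap[i,n]|$ and $|v|_i(\mathbf{x},\mathbf{y})=|v_i(\mathbf{x},\mathbf{y})|$. For a commutative ring $R$, $R^{V}$ is the ring of functions $V\to R$, and an algebra over $R^{V}$ is a ring equipped with a ring homomorphism from $R^V$; isomorphisms must respect this homomorphism. The algebra $\mathcal{B}_0(n,k)$: it is the free $\mathbb{F}_2[U_1,\ldots,U_n]$-module with basis $\{f_{\mathbf{x},\mathbf{y}} : \mathbf{x},\mathbf{y}\in V(n,k)\}$, with $\mathbb{F}_2[U_1,\ldots,U_n]$-bilinear multiplication $$f_{\mathbf{x},\mathbf{y}}f_{\mathbf{y},\mathbf{z}}=\prod_{i=1}^n U_i^{(|v|_i(\mathbf{y},\mathbf{z})-|v|_i(\mathbf{x},\mathbf{z})+|v|_i(\mathbf{x},\mathbf{y}))/2}\,f_{\mathbf{x},\mathbf{z}},\qquad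 f_{\mathbf{x},\mathbf{y}}f_{\mathbf{y}',\mathbf{z}}=0\ \text{ if } \mathbf{y}\ne\mathbf{y}'$$ (the exponents are always nonnegative integers). The idempotents are $\mathbf{I}_{\mathbf{x}}=f_{\mathbf{x},\mathbf{x}}$, and $\mathcal{B}_0(n,k)$ is an algebra over $\mathbb{F}_2[U_1,\ldots,U_n]^{V(n,k)}$ via $p\cdot\mathbf{I}_{\mathbf{x}}\mapsto p f_{\mathbf{x},\mathbf{x}}$. Path algebras: the path algebra of a finite directed graph over a commutative ring $R$ is the free $R$-module on all paths (including a length-zero path $\mathbf{I}_v$ at each vertex $v$), with product of two paths $\gamma\gamma'$ equal to the concatenation ''$\gamma$ first, then $\gamma'$'' if the end of $\gamma$ is the start of $\gamma'$, and $0$ otherwise. The quiver $\Gamma(n,k)$ has vertex set $V(n,k)$ and the following labeled arrows: for each $\mathbf{x}$ with $i-1\in\mathbf{x}$, $i\notin\mathbf{x}$, an arrow labeled $R_i$ from $\mathbf{x}$ to $(\mathbf{x}\setminus\{i-1\})\cup\{i\}$; for each $\mathbf{x}$ with $i\in\mathbf{x}$, $i-1\notin\mathbf{x}$, an arrow labeled $L_i$ from $\mathbf{x}$ to $(\mathbf{x}\setminus\{i\})\cup\{i-1\}$; for each $\mathbf{x}$ and each $1\le i\le n$, a loop labeled $U_i$ at $\mathbf{x}$. To a path associate the noncommutative monomial in its labels, and extend linearly. The relation set $\mathcal{R}$ consists of all $\mathbb{F}_2$-linear combinations of paths with a common start $\mathbf{x}$ and common end $\mathbf{y}$ (for all $\mathbf{x},\mathbf{y}$)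 whose associated expression is one of: (1) $R_iU_j-U_jR_i$, $L_iU_j-U_jL_i$, $U_iU_j-U_jU_i$; (2) $R_iL_i-U_i$, $L_iR_i-U_i$; (3) $R_iR_j-R_jR_i$, $L_iL_j-L_jL_i$, $R_iL_j-L_jR_i$ for $|i-j|>1$. $\mathrm{Quiv}(\Gamma(n,k),\mathcal{R})$ is an algebra over $\mathbb{F}_2[U_1,\ldots,U_n]^{V(n,k)}$ by sending $\mathbf{I}_{\mathbf{x}}$ to $\mathbf{I}_{\mathbf{x}}$ and $U_i\mathbf{I}_{\mathbf{x}}$ to the $U_i$ loop at $\mathbf{x}$. *)

(* Defs.v *)
From HB Require Import structures.
From mathcomp Require Import all_boot all_order all_algebra.
From mathcomp Require Import boolp finmap zify.
From mathcomp Require Import -(notations) mpoly.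
From mathcomp Require Import monalg.

Set Implicit Arguments.
Unset Strict Implicit.
Unset Printing Implicit Defensive.

Import GRing.Theory Num.Theory.

Local Open Scope ring_scope.

Section LinearExtension.
Variables (R : comNzRingType) (K : choiceType) (V : lmodType R).
Implicit Types (h : K -> V) (f g : {malg R[K]}).

Definition linext h f : V := \sum_(k <- msupp f) f@_k *: h k.

Lemma linextEw h f (d : {fset K}) : (msupp f `<=` d)%fset ->
  linext h f = \sum_(k <- d) f@_k *: h k.
Proof.
move=> le; rewrite [LHS](big_fset_incl _ le) => //= x xd /mcoeff_outdom ->.
by rewrite scale0r.
Qed.

Lemma linext0 h : linext h 0 = 0.
Proof. by rewrite /linext msupp0 big_seq_fset0. Qed.

Lemma linextD h f g : linext h (f + g) = linext h f + linext h g.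
Proof.
rewrite (linextEw h (msuppD_le f g)).
rewrite (linextEw h (fsubsetUl (msupp f) (msupp g))).
rewrite (linextEw h (fsubsetUr (msupp f) (msupp g))).
by rewrite -big_split; apply: eq_bigr => k _; rewrite mcoeffD scalerDl.
Qed.

Lemma linextU h c k : linext h << c *g k >> = c *: h k.
Proof. by rewrite (linextEw h msuppU_le) big_seq_fset1 mcoeffUU. Qed.

Lemma linextZ h c f : linext h (c *: f) = c *: linext h f.
Proof.
rewrite (linextEw h (msuppZ_le c f)) scaler_sumr.
by apply: eq_bigr => k _; rewrite mcoeffZ scalerA.
Qed.

Lemma linext_eq h1 h2 f : h1 =1 h2 -> linext h1 f = linext h2 f.
Proof. by move=> e; apply: eq_bigr => k _; rewrite e. Qed.

Lemma linext_addf h1 h2 f :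
  linext (fun k => h1 k + h2 k) f = linext h1 f + linext h2 f.
Proof. by rewrite -big_split; apply: eq_bigr => k _; rewrite scalerDr. Qed.

Lemma linext_scalef c h f : linext (fun k => c *: h k) f = c *: linext h f.
Proof.
by rewrite scaler_sumr; apply: eq_bigr => k _; rewrite !scalerA mulrC.
Qed.

End LinearExtension.

Fact delta_key : unit. Proof. exact: tt. Qed.

(* Basis elements; locked, since a failing conversion between two terms of the
   form << k >> diverges. *)
Definition delta (R : comNzRingType) (K : choiceType) : K -> {malg R[K]} :=
  locked_with delta_key (fun k => << k >>).
Arguments delta {R K} k.

Lemma deltaE (R : comNzRingType) (K : choiceType) (k : K) :
  delta k = << k >> :> {malg R[K]}.
Proof. by rewrite /delta unlock. Qed.

Lemma deltaZE (R : comNzRingType) (K : choiceType) (c : R) (k : K) :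
  c *: delta k = << c *g k >>.
Proof.
by rewrite deltaE; apply/malgP=> b; rewrite mcoeffZ !mcoeffU mulrnAr mulr1.
Qed.

Lemma linext_delta (R : comNzRingType) (K : choiceType) (V : lmodType R)
    (h : K -> V) k : linext h (delta k) = h k.
Proof. by rewrite deltaE linextU scale1r. Qed.

Lemma malg_ind (R : comNzRingType) (K : choiceType) (P : {malg R[K]} -> Prop) :
  P 0 -> (forall f g, P f -> P g -> P (f + g)) ->
  (forall c k, P (c *: delta k)) -> forall f, P f.
Proof.
move=> P0 PD PU f; rewrite [f]monalgE; elim/big_ind: _ => // k _.
by rewrite -deltaZE.
Qed.

Section BilinearExtension.
Variables (R : comNzRingType) (K : choiceType) (mu : K -> K -> {malg R[K]}).
Implicit Types (f g h : {malg R[K]}).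

Fact bilinext_key : unit. Proof. exact: tt. Qed.

(* The bilinear extension of mu; locked to keep conversion from expanding it. *)
Definition bilinext : {malg R[K]} -> {malg R[K]} -> {malg R[K]} :=
  locked_with bilinext_key (fun f g => linext (fun a => linext (mu a) g) f).

Lemma bilinextE f g : bilinext f g = linext (fun a => linext (mu a) g) f.
Proof. by rewrite /bilinext unlock. Qed.

Lemma bilinextU a b : bilinext (delta a) (delta b) = mu a b.
Proof. by rewrite !bilinextE !linext_delta. Qed.

Lemma bilinext0l g : bilinext 0 g = 0.
Proof. by rewrite bilinextE linext0. Qed.

Lemma bilinext0r f : bilinext f 0 = 0.
Proof. by rewrite !bilinextE /linext msupp0 big1 // => k _; rewrite big_seq_fset0 scaler0. Qed.

Lemma bilinextDl : left_distributive bilinext +%R.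
Proof. by move=> f g h; rewrite !bilinextE linextD. Qed.

Lemma bilinextDr : right_distributive bilinext +%R.
Proof.
move=> f g h; rewrite !bilinextE -linext_addf.
by apply: linext_eq => a; rewrite linextD.
Qed.

Lemma bilinextZl c f g : bilinext (c *: f) g = c *: bilinext f g.
Proof. by rewrite !bilinextE linextZ. Qed.

Lemma bilinextZr c f g : bilinext f (c *: g) = c *: bilinext f g.
Proof.
by rewrite !bilinextE -linext_scalef; apply: linext_eq => a; rewrite linextZ.
Qed.

Lemma bilinext_suml I (r : seq I) (F : I -> {malg R[K]}) g :
  bilinext (\sum_(i <- r) F i) g = \sum_(i <- r) bilinext (F i) g.
Proof.
exact: (big_morph (bilinext ^~ g) (fun f h => bilinextDl f h g) (bilinext0l g)).
Qed.

Lemma bilinext_sumr I (r : seq I) (F : I -> {malg R[K]}) g :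
  bilinext g (\sum_(i <- r) F i) = \sum_(i <- r) bilinext g (F i).
Proof. exact: (big_morph _ (bilinextDr g) (bilinext0r g)). Qed.

Lemma bilinextA :
  (forall a b c, bilinext (delta a) (mu b c) = bilinext (mu a b) (delta c)) ->
  associative bilinext.
Proof.
move=> muA f g h; elim/malg_ind: f => [|f1 f2 I1 I2|c a].
- by rewrite !bilinext0l.
- by rewrite !bilinextDl I1 I2.
rewrite !bilinextZl; congr (_ *: _); elim/malg_ind: g => [|f1 f2 I1 I2|d b].
- by rewrite bilinext0l !bilinext0r bilinext0l.
- by rewrite bilinextDr !bilinextDl bilinextDr I1 I2.
rewrite bilinextZl !bilinextZr bilinextZl; congr (_ *: _).
elim/malg_ind: h => [|f1 f2 I1 I2|e x].
- by rewrite !bilinext0r.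
- by rewrite !bilinextDr I1 I2.
by rewrite !bilinextZr !bilinextU muA.
Qed.

Lemma bilinext1l e : (forall a, bilinext e (delta a) = (delta a)) ->
  left_id e bilinext.
Proof.
move=> ee f; elim/malg_ind: f => [|f1 f2 I1 I2|c a]; first exact: bilinext0r.
- by rewrite bilinextDr I1 I2.
- by rewrite bilinextZr ee.
Qed.

Lemma bilinext1r e : (forall a, bilinext (delta a) e = (delta a)) ->
  right_id e bilinext.
Proof.
move=> ee f; elim/malg_ind: f => [|f1 f2 I1 I2|c a]; first exact: bilinext0l.
- by rewrite bilinextDl I1 I2.
- by rewrite bilinextZl ee.
Qed.

End BilinearExtension.

Record quiver := Quiver {
  vert : finType;
  arr : finType;
  src : arr -> vert;
  tgt : arr -> vert }.

Section PathAlgebra.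
Variable Q : quiver.

Fixpoint walk (x : vert Q) (s : seq (arr Q)) : bool :=
  if s is a :: s' then (src a == x) && walk (tgt a) s' else true.

Definition qpath := {p : vert Q * seq (arr Q) | walk p.1 p.2}.

Definition pstart (p : qpath) : vert Q := (val p).1.
Definition parrows (p : qpath) : seq (arr Q) := (val p).2.
Definition pend (p : qpath) : vert Q :=
  last (pstart p) [seq tgt a | a <- parrows p].

Definition pvert (x : vert Q) : qpath := exist _ (x, [::]) isT.

Lemma walk1 (a : arr Q) : walk (src a) [:: a].
Proof. by rewrite /= eqxx. Qed.

Definition parrow (a : arr Q) : qpath := exist _ (src a, [:: a]) (walk1 a).

(* Concatenation, first p then q; junk value p unless pend p = pstart q. *)
Definition pcat (p q : qpath) : qpath :=
  insubd p (pstart p, parrows p ++ parrows q).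

Lemma walk_cat x s t :
  walk x (s ++ t) = walk x s && walk (last x [seq tgt a | a <- s]) t.
Proof. by elim: s x => //= a s IH x; rewrite IH andbA. Qed.

Lemma val_pcat p q : pend p = pstart q ->
  val (pcat p q) = (pstart p, parrows p ++ parrows q).
Proof.
move=> e; rewrite val_insubd /= walk_cat (valP p) /=.
by move: e; rewrite /pend /pstart /parrows => ->; rewrite (valP q).
Qed.

Lemma pstart_pcat p q : pend p = pstart q -> pstart (pcat p q) = pstart p.
Proof. by move=> /val_pcat e; rewrite /pstart e. Qed.

Lemma pend_pcat p q : pend p = pstart q -> pend (pcat p q) = pend q.
Proof.
move=> e; rewrite /pend pstart_pcat // /parrows val_pcat //= map_cat last_cat.
by congr last.
Qed.

Lemma pcatA p q r : pend p = pstart q -> pend q = pstart r ->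
  pcat p (pcat q r) = pcat (pcat p q) r.
Proof.
move=> e1 e2; apply: val_inj; rewrite !val_pcat ?pstart_pcat ?pend_pcat //.
by rewrite /parrows !val_pcat //= catA.
Qed.

Lemma pcat1p p : pcat (pvert (pstart p)) p = p.
Proof. by apply: val_inj; rewrite val_pcat //; case: p => -[]. Qed.

Lemma pcatp1 p : pcat p (pvert (pend p)) = p.
Proof.
by apply: val_inj; rewrite val_pcat //= cats0; case: p => -[].
Qed.

Variable R : comNzRingType.

Definition pathmul (p q : qpath) : {malg R[qpath]} :=
  if pend p == pstart q then delta (pcat p q) else 0.

Definition path_algebra : Type := {malg R[qpath]}.

HB.instance Definition _ := Choice.on path_algebra.
HB.instance Definition _ := GRing.Lmodule.on path_algebra.

Definition pathalg_one : path_algebra := \sum_(x : vert Q) delta (pvert x).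
Definition pathalg_mul : path_algebra -> path_algebra -> path_algebra :=
  bilinext pathmul.

Lemma pathmul_cat p q : pend p = pstart q -> pathmul p q = delta (pcat p q).
Proof. by rewrite /pathmul => ->; rewrite eqxx. Qed.

Lemma pathmul_eq0 p q : pend p != pstart q -> pathmul p q = 0.
Proof. by rewrite /pathmul => /negPf ->. Qed.

Lemma pathalg_mulA : associative pathalg_mul.
Proof.
apply: bilinextA => p q r.
have [e1|n1] := eqVneq (pend p) (pstart q); last first.
  rewrite (pathmul_eq0 n1) (bilinext0l _ (delta r)).
  have [e2|n2] := eqVneq (pend q) (pstart r); last first.
    by rewrite (pathmul_eq0 n2) bilinext0r.
  by rewrite (pathmul_cat e2) bilinextU pathmul_eq0 // pstart_pcat.
have E c : bilinext pathmul (pathmul p q) (delta c) = pathmul (pcat p q) c.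
  by rewrite (pathmul_cat e1); exact: bilinextU.
rewrite {}E; have [e2|n2] := eqVneq (pend q) (pstart r); last first.
  by rewrite (pathmul_eq0 n2) bilinext0r pathmul_eq0 // pend_pcat.
have E : bilinext pathmul (delta p) (pathmul q r) = pathmul p (pcat q r).
  by rewrite (pathmul_cat e2); exact: bilinextU.
have e1' : pend p = pstart (pcat q r) by rewrite pstart_pcat.
have e2' : pend (pcat p q) = pstart r by rewrite pend_pcat.
by rewrite {}E (pathmul_cat e1') (pathmul_cat e2') (pcatA e1 e2).
Qed.

Lemma pathalg_mul1l : left_id pathalg_one pathalg_mul.
Proof.
apply: bilinext1l => p; rewrite bilinext_suml (bigD1 (pstart p)) //= big1.
  by rewrite bilinextU pathmul_cat // pcat1p addr0.
by move=> x nx; rewrite bilinextU pathmul_eq0.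
Qed.

Lemma pathalg_mul1r : right_id pathalg_one pathalg_mul.
Proof.
apply: bilinext1r => p; rewrite bilinext_sumr (bigD1 (pend p)) //= big1.
  by rewrite bilinextU pathmul_cat // pcatp1 addr0.
by move=> x nx; rewrite bilinextU pathmul_eq0 // eq_sym.
Qed.

HB.instance Definition _ := GRing.Zmodule_isPzRing.Build path_algebra
  pathalg_mulA pathalg_mul1l pathalg_mul1r (bilinextDl pathmul)
  (bilinextDr pathmul).

End PathAlgebra.

Arguments pvert {Q} x.
Arguments parrow {Q} a.

Section Quotient.
Variables (A : pzRingType) (S : A -> Prop).

Definition two_sided_ideal (I : A -> Prop) : Prop :=
  [/\ I 0, forall a b, I a -> I b -> I (a - b)
    & forall c a, I a -> I (c * a) /\ I (a * c)].

Definition gen_ideal (a : A) : Prop :=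
  forall I, two_sided_ideal I -> (forall s, S s -> I s) -> I a.

Lemma gen_idealP : two_sided_ideal gen_ideal.
Proof.
split=> [I [] //|a b Ia Ib I iI sI|c a Ia].
  by have [_ + _] := iI; apply; [exact: Ia|exact: Ib].
by split=> I iI sI; have [_ _ /(_ c a (Ia I iI sI)) []] := iI.
Qed.

Lemma gen_ideal_gen s : S s -> gen_ideal s.
Proof. by move=> Ss I _; apply. Qed.

Lemma gen_ideal0 : gen_ideal 0.
Proof. by have [] := gen_idealP. Qed.

Lemma gen_idealB a b : gen_ideal a -> gen_ideal b -> gen_ideal (a - b).
Proof. by have [_ + _] := gen_idealP; apply. Qed.

Lemma gen_idealN a : gen_ideal a -> gen_ideal (- a).
Proof. by move=> /(gen_idealB gen_ideal0); rewrite sub0r. Qed.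

Lemma gen_idealD a b : gen_ideal a -> gen_ideal b -> gen_ideal (a + b).
Proof. by move=> Ia /gen_idealN /(gen_idealB Ia); rewrite opprK. Qed.

Lemma gen_idealMl c a : gen_ideal a -> gen_ideal (c * a).
Proof. by have [_ _ I] := gen_idealP => /(I c) []. Qed.

Lemma gen_idealMr c a : gen_ideal a -> gen_ideal (a * c).
Proof. by have [_ _ I] := gen_idealP => /(I c) []. Qed.

Definition ideal_rel : rel A := fun a b => `[< gen_ideal (a - b) >].

Lemma ideal_rel_refl : reflexive ideal_rel.
Proof. by move=> a; apply/asboolP; rewrite subrr; exact: gen_ideal0. Qed.

Lemma ideal_rel_sym : ssrbool.symmetric ideal_rel.
Proof.
suff h a b : ideal_rel a b -> ideal_rel b a by move=> a b; apply/idP/idP; exact: h.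
by move=> /asboolP /gen_idealN H; apply/asboolP; rewrite -opprB.
Qed.

Lemma ideal_rel_trans : transitive ideal_rel.
Proof.
move=> b a c /asboolP ab /asboolP bc; apply/asboolP.
by have := gen_idealD ab bc; rewrite addrA subrK.
Qed.

Canonical ideal_equiv :=
  EquivRel ideal_rel ideal_rel_refl ideal_rel_sym ideal_rel_trans.

Local Open Scope quotient_scope.

Definition quotient_ring : Type := {eq_quot ideal_equiv}.

HB.instance Definition _ := Choice.on quotient_ring.
HB.instance Definition _ := EqQuotient.on quotient_ring.

Definition quot_pi (a : A) : quotient_ring := \pi_quotient_ring a.

Lemma quot_piP a b : quot_pi a = quot_pi b <-> gen_ideal (a - b).
Proof. by split=> [/eqmodP /asboolP | H]; [|apply/eqmodP/asboolP]. Qed.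

Lemma quot_surj (u : quotient_ring) : exists a, u = quot_pi a.
Proof. by exists (repr u); rewrite /quot_pi reprK. Qed.

Lemma repr_pi a : gen_ideal (repr (quot_pi a) - a).
Proof. by apply/quot_piP; rewrite /quot_pi reprK. Qed.

Definition quot_zero : quotient_ring := quot_pi 0.
Definition quot_one : quotient_ring := quot_pi 1.
Definition quot_opp (u : quotient_ring) : quotient_ring := quot_pi (- repr u).
Definition quot_add (u v : quotient_ring) : quotient_ring :=
  quot_pi (repr u + repr v).
Definition quot_mul (u v : quotient_ring) : quotient_ring :=
  quot_pi (repr u * repr v).

Lemma quot_oppE a : quot_opp (quot_pi a) = quot_pi (- a).
Proof. by apply/quot_piP; rewrite -opprD; apply: gen_idealN; exact: repr_pi. Qed.

Lemma quot_addE a b : quot_add (quot_pi a) (quot_pi b) = quot_pi (a + b).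
Proof.
by apply/quot_piP; rewrite opprD addrACA; apply: gen_idealD; exact: repr_pi.
Qed.

Lemma quot_mulE a b : quot_mul (quot_pi a) (quot_pi b) = quot_pi (a * b).
Proof.
apply/quot_piP; set a' := repr _; set b' := repr _.
have -> : a' * b' - a * b = (a' - a) * b' + a * (b' - b).
  by rewrite mulrBl mulrBr addrA subrK.
apply: gen_idealD; first by apply: gen_idealMr; exact: repr_pi.
by apply: gen_idealMl; exact: repr_pi.
Qed.

Lemma quot_addA : associative quot_add.
Proof.
move=> u v w; have [a ->] := quot_surj u; have [b ->] := quot_surj v.
by have [c ->] := quot_surj w; rewrite !quot_addE addrA.
Qed.

Lemma quot_addC : commutative quot_add.
Proof.
move=> u v; have [a ->] := quot_surj u; have [b ->] := quot_surj v.
by rewrite !quot_addE addrC.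
Qed.

Lemma quot_add0 : left_id quot_zero quot_add.
Proof. by move=> u; have [a ->] := quot_surj u; rewrite quot_addE add0r. Qed.

Lemma quot_addN : left_inverse quot_zero quot_opp quot_add.
Proof.
by move=> u; have [a ->] := quot_surj u; rewrite quot_oppE quot_addE addNr.
Qed.

HB.instance Definition _ := GRing.isZmodule.Build quotient_ring
  quot_addA quot_addC quot_add0 quot_addN.

Lemma quot_mulA : associative quot_mul.
Proof.
move=> u v w; have [a ->] := quot_surj u; have [b ->] := quot_surj v.
by have [c ->] := quot_surj w; rewrite !quot_mulE mulrA.
Qed.

Lemma quot_mul1l : left_id quot_one quot_mul.
Proof. by move=> u; have [a ->] := quot_surj u; rewrite quot_mulE mul1r. Qed.

Lemma quot_mul1r : right_id quot_one quot_mul.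
Proof. by move=> u; have [a ->] := quot_surj u; rewrite quot_mulE mulr1. Qed.

Lemma quot_mulDl : left_distributive quot_mul quot_add.
Proof.
move=> u v w; have [a ->] := quot_surj u; have [b ->] := quot_surj v.
by have [c ->] := quot_surj w; rewrite !(quot_mulE, quot_addE) mulrDl.
Qed.

Lemma quot_mulDr : right_distributive quot_mul quot_add.
Proof.
move=> u v w; have [a ->] := quot_surj u; have [b ->] := quot_surj v.
by have [c ->] := quot_surj w; rewrite !(quot_mulE, quot_addE) mulrDr.
Qed.

HB.instance Definition _ := GRing.Zmodule_isPzRing.Build quotient_ring
  quot_mulA quot_mul1l quot_mul1r quot_mulDl quot_mulDr.

Lemma quot_pi_is_zmod_morphism : zmod_morphism quot_pi.
Proof. by move=> a b; rewrite -quot_addE -quot_oppE. Qed.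

Lemma quot_pi_is_monoid_morphism : monoid_morphism quot_pi.
Proof. by split=> // a b; rewrite -quot_mulE. Qed.

HB.instance Definition _ := GRing.isZmodMorphism.Build A quotient_ring quot_pi
  quot_pi_is_zmod_morphism.
HB.instance Definition _ := GRing.isMonoidMorphism.Build A quotient_ring quot_pi
  quot_pi_is_monoid_morphism.

End Quotient.

(* A ring equipped with a ring homomorphism from S is an algebra over S. *)
Definition isomorphic_over (S A B : pzRingType)
    (iA : {rmorphism S -> A}) (iB : {rmorphism S -> B}) : Prop :=
  exists phi : {rmorphism A -> B},
    bijective phi /\ forall s : S, phi (iA s) = iB s.

(* V(n,k); the ambient set [0,n] is 'I_n.+1. *)
Definition states (n k : nat) := {x : {set 'I_n.+1} | #|x| == k}.

(* An index i : 'I_n stands for the 1-based index i.+1 in [1,n]: the arrow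
   labels R_(i+1), L_(i+1) and U_(i+1) are Rl i, Ll i and Ul i, and prv i, nxt i
   are the elements i and i+1 of [0,n]. *)
Definition prv n (i : 'I_n) : 'I_n.+1 := widen_ord (leqnSn n) i.
Definition nxt n (i : 'I_n) : 'I_n.+1 := lift ord0 i.

Variant label (n : nat) := Rl of 'I_n | Ll of 'I_n | Ul of 'I_n.

Definition label_code n (l : label n) : 'I_n + ('I_n + 'I_n) :=
  match l with Rl i => inl i | Ll i => inr (inl i) | Ul i => inr (inr i) end.
Definition label_decode n (c : 'I_n + ('I_n + 'I_n)) : label n :=
  match c with inl i => Rl i | inr (inl i) => Ll i | inr (inr i) => Ul i end.
Lemma label_codeK n : cancel (@label_code n) (@label_decode n).
Proof. by case. Qed.
HB.instance Definition _ n := Finite.copy (label n) (can_type (@label_codeK n)).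

Section Gamma.
Variables n k : nat.

Definition is_arrow (x : states n k) (l : label n) (y : states n k) : bool :=
  match l with
  | Rl i => [&& prv i \in val x, nxt i \notin val x
              & val y == nxt i |: (val x :\ prv i)]
  | Ll i => [&& nxt i \in val x, prv i \notin val x
              & val y == prv i |: (val x :\ nxt i)]
  | Ul _ => y == x
  end.

Definition arrow :=
  {a : states n k * label n * states n k | is_arrow a.1.1 a.1.2 a.2}.

Definition arrow_src (a : arrow) : states n k := (val a).1.1.
Definition arrow_label (a : arrow) : label n := (val a).1.2.
Definition arrow_tgt (a : arrow) : states n k := (val a).2.

Definition Gamma : quiver := Quiver arrow_src arrow_tgt.

Definition Uloop (x : states n k) (i : 'I_n) : arrow :=
  exist _ (x, Ul i, x) (eqxx x).

(* The free algebra F_2<R_i, L_i, U_i>. *)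
Definition nc_poly : pzRingType := {malg 'F_2[{fmonom (label n)}]}.

Definition nc_var (l : label n) : nc_poly := delta (FMonom [:: l]).

Definition path_word (p : qpath Gamma) : {fmonom (label n)} :=
  FMonom [seq arrow_label a | a <- parrows p].

Definition label_expr (a : path_algebra Gamma 'F_2) : nc_poly :=
  linext (fun p => (delta (path_word p) : {malg 'F_2[{fmonom (label n)}]})) a.

Definition common_ends (x y : states n k) (a : path_algebra Gamma 'F_2) : Prop :=
  forall p, p \in msupp a -> pstart p = x /\ pend p = y.

Local Notation R i := (nc_var (Rl i)).
Local Notation L i := (nc_var (Ll i)).
Local Notation U i := (nc_var (Ul i)).

Variant rel_expr : nc_poly -> Prop :=
  | Rel_RU i j : rel_expr (R i * U j - U j * R i)
  | Rel_LU i j : rel_expr (L i * U j - U j * L i)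
  | Rel_UU i j : rel_expr (U i * U j - U j * U i)
  | Rel_RL i : rel_expr (R i * L i - U i)
  | Rel_LR i : rel_expr (L i * R i - U i)
  | Rel_RRC (i j : 'I_n) & (1 < `|i - j|)%N : rel_expr (R i * R j - R j * R i)
  | Rel_LLC (i j : 'I_n) & (1 < `|i - j|)%N : rel_expr (L i * L j - L j * L i)
  | Rel_RLC (i j : 'I_n) & (1 < `|i - j|)%N : rel_expr (R i * L j - L j * R i).

Definition relations (a : path_algebra Gamma 'F_2) : Prop :=
  exists x y, common_ends x y a /\ rel_expr (label_expr a).

Definition Quiv : pzRingType := quotient_ring relations.

End Gamma.

(* F_2[U_1, ..., U_n] and its variable U_(i+1). *)
Notation Upoly n := (mpoly.mpoly n 'F_2).
Notation Uvar i := (mpolyX 'F_2 (mnm1 i)).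

Section B0.
Variables n k : nat.

Definition vdiff (x y : states n k) (i : 'I_n) : int :=
  (#|val y :&: [set j : 'I_n.+1 | (i < j)%N]|)%:Z
    - (#|val x :&: [set j : 'I_n.+1 | (i < j)%N]|)%:Z.

Definition absv (x y : states n k) (i : 'I_n) : nat := `|vdiff x y i|%N.

(* The truncated subtraction and the halving are exact: see Uexp_double. *)
Definition Uexp (x y z : states n k) (i : 'I_n) : nat :=
  ((absv y z i + absv x y i - absv x z i)./2)%N.

Lemma Uexp_double x y z i :
  ((Uexp x y z i).*2 + absv x z i = absv y z i + absv x y i)%N.
Proof. by rewrite /Uexp /absv /vdiff; lia. Qed.

Lemma Uexp_assoc x y z w i :
  (Uexp x y z i + Uexp x z w i = Uexp y z w i + Uexp x y w i)%N.
Proof.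
have := Uexp_double x y z i; have := Uexp_double x z w i.
by have := Uexp_double y z w i; have := Uexp_double x y w i; lia.
Qed.

Lemma Uexp_xxy x y i : Uexp x x y i = 0%N.
Proof. by rewrite /Uexp /absv /vdiff; lia. Qed.

Lemma Uexp_xyy x y i : Uexp x y y i = 0%N.
Proof. by rewrite /Uexp /absv /vdiff; lia. Qed.

Definition Umon (x y z : states n k) : Upoly n :=
  \prod_(i < n) Uvar i ^+ Uexp x y z i.

Lemma Umon_assoc x y z w : Umon x y z * Umon x z w = Umon y z w * Umon x y w.
Proof.
rewrite /Umon -!big_split /=; apply: eq_bigr => i _.
by rewrite -!exprD Uexp_assoc.
Qed.

Lemma Umon_xxy x y : Umon x x y = 1.
Proof. by rewrite /Umon big1 // => i _; rewrite Uexp_xxy. Qed.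

Lemma Umon_xyy x y : Umon x y y = 1.
Proof. by rewrite /Umon big1 // => i _; rewrite Uexp_xyy. Qed.

(* The pair (x, y) indexes the basis element f_(x,y). *)
Definition B0_basis_mul (p q : states n k * states n k) :
    {malg (Upoly n)[(states n k * states n k)%type]} :=
  if p.2 == q.1 then Umon p.1 p.2 q.2 *: delta (p.1, q.2) else 0.

Definition B0 : Type := {malg (Upoly n)[(states n k * states n k)%type]}.

HB.instance Definition _ := GRing.Lmodule.copy B0
  {malg (Upoly n)[(states n k * states n k)%type]}.

Definition B0_one : B0 := \sum_(x : states n k) delta (x, x).
Definition B0_mul : B0 -> B0 -> B0 := bilinext B0_basis_mul.

Lemma B0_basis_mulE x y z :
  B0_basis_mul (x, y) (y, z) = Umon x y z *: delta (x, z).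
Proof. by rewrite /B0_basis_mul eqxx. Qed.

Lemma B0_basis_mul0 x y y' z : y != y' -> B0_basis_mul (x, y) (y', z) = 0.
Proof. by rewrite /B0_basis_mul /= => /negPf ->. Qed.

Lemma B0_mulA : associative B0_mul.
Proof.
apply: bilinextA => -[x y] [y' z] [z' w].
pose BU := bilinextU B0_basis_mul.
have [<-{y'}|ny] := eqVneq y y'; last first.
  rewrite (B0_basis_mul0 x z ny) (bilinext0l _ (delta (z', w))).
  have [<-{z'}|nz] := eqVneq z z'; last first.
    by rewrite (B0_basis_mul0 y' w nz) (bilinext0r _ (delta (x, y))).
  by rewrite B0_basis_mulE bilinextZr BU (B0_basis_mul0 x w ny) scaler0.
have E : bilinext B0_basis_mul (B0_basis_mul (x, y) (y, z)) (delta (z', w)) =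
    Umon x y z *: B0_basis_mul (x, z) (z', w).
  by rewrite B0_basis_mulE bilinextZl BU.
rewrite {}E; have [<-{z'}|nz] := eqVneq z z'; last first.
  rewrite (B0_basis_mul0 y w nz) (B0_basis_mul0 x w nz) scaler0.
  exact: bilinext0r.
have E : bilinext B0_basis_mul (delta (x, y)) (B0_basis_mul (y, z) (z, w)) =
    Umon y z w *: B0_basis_mul (x, y) (y, w).
  by rewrite B0_basis_mulE bilinextZr BU.
by rewrite {}E !B0_basis_mulE !scalerA Umon_assoc.
Qed.

Lemma B0_mul1l : left_id B0_one B0_mul.
Proof.
apply: bilinext1l => -[x y]; rewrite bilinext_suml (bigD1 x) //= big1.
  by rewrite addr0 bilinextU B0_basis_mulE Umon_xxy scale1r.
by move=> z nz; rewrite bilinextU B0_basis_mul0.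
Qed.

Lemma B0_mul1r : right_id B0_one B0_mul.
Proof.
apply: bilinext1r => -[x y]; rewrite bilinext_sumr (bigD1 y) //= big1.
  by rewrite addr0 bilinextU B0_basis_mulE Umon_xyy scale1r.
by move=> z nz; rewrite bilinextU B0_basis_mul0 // eq_sym.
Qed.

HB.instance Definition _ := GRing.Zmodule_isPzRing.Build B0
  B0_mulA B0_mul1l B0_mul1r (bilinextDl B0_basis_mul) (bilinextDr B0_basis_mul).

Lemma B0_deltaM x y z :
  (delta (x, y) : B0) * delta (y, z) = Umon x y z *: (delta (x, z) : B0).
Proof. by rewrite -B0_basis_mulE -(bilinextU B0_basis_mul). Qed.

Lemma B0_deltaM0 x y y' z : y != y' ->
  (delta (x, y) : B0) * delta (y', z) = 0.
Proof. by move=> e; rewrite -(B0_basis_mul0 x z e) -(bilinextU B0_basis_mul). Qed.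

(* The ring F_2[U_1, ..., U_n]^V(n,k). *)
Definition idem_ring : pzRingType := {ffun states n k -> Upoly n}.

Definition B0_unit (f : idem_ring) : B0 := \sum_(x : states n k) f x *: delta (x, x).

Lemma B0_unit_is_zmod_morphism : zmod_morphism B0_unit.
Proof.
move=> f g; rewrite /B0_unit -sumrB; apply: eq_bigr => x _.
by rewrite !ffunE scalerBl.
Qed.

Lemma B0_unit_is_monoid_morphism : monoid_morphism B0_unit.
Proof.
split=> [|f g].
  by rewrite /B0_unit; apply: eq_bigr => x _; rewrite ffunE scale1r.
rewrite -[RHS]/(bilinext B0_basis_mul _ _) bilinext_suml; apply: eq_bigr => x _.
rewrite bilinext_sumr (bigD1 x) //= big1 ?addr0 => [|y ny].
  by rewrite bilinextZl bilinextZr bilinextU B0_basis_mulE Umon_xxy scale1r scalerA ffunE.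
by rewrite bilinextZl bilinextZr bilinextU B0_basis_mul0 ?scaler0 // eq_sym.
Qed.

HB.instance Definition _ := GRing.isZmodMorphism.Build idem_ring B0 B0_unit
  B0_unit_is_zmod_morphism.
HB.instance Definition _ := GRing.isMonoidMorphism.Build idem_ring B0 B0_unit
  B0_unit_is_monoid_morphism.

End B0.

Section QuivUnit.
Variables n k : nat.
Local Notation PA := (path_algebra (Gamma n k) 'F_2).
Local Notation pi := (@quot_pi PA (@relations n k)).
Implicit Types (x y : states n k) (i j : 'I_n) (m : multinom n).

Definition pidem x : PA := delta (pvert (x : vert (Gamma n k))).
Definition ploop x i : PA := delta (parrow (Uloop x i : arr (Gamma n k))).

Definition loop_monomial x m : PA :=
  pidem x * \prod_(i < n) ploop x i ^+ m i.

Definition loop_eval x (p : Upoly n) : PA :=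
  \sum_(m <- mpoly.msupp p) mpoly.mcoeff m p *: loop_monomial x m.

(* p I_x goes to the value of p at the loops U_i based at x. *)
Definition Quiv_unit (f : idem_ring n k) : Quiv n k :=
  pi (\sum_(x : states n k) loop_eval x (f x)).

Lemma path_algebra_mulU (p q : qpath (Gamma n k)) : pend p = pstart q ->
  (delta p : PA) * delta q = delta (pcat p q).
Proof.
by move=> e; rewrite -(pathmul_cat 'F_2 e) -(bilinextU (@pathmul _ _)).
Qed.

Lemma path_algebra_mulU0 (p q : qpath (Gamma n k)) : pend p != pstart q ->
  (delta p : PA) * delta q = 0.
Proof.
by move=> e; rewrite -(pathmul_eq0 'F_2 e) -(bilinextU (@pathmul _ _)).
Qed.

Lemma pidem_idem x : pidem x * pidem x = pidem x.
Proof.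
pose v := pvert (x : vert (Gamma n k)).
have e : pend v = pstart v by [].
by rewrite /pidem (path_algebra_mulU e) (pcat1p v).
Qed.

Lemma pidem_orth x y : x != y -> pidem x * pidem y = 0.
Proof. by move=> nxy; exact: path_algebra_mulU0. Qed.

Lemma pidem_ploop x i : pidem x * ploop x i = ploop x i.
Proof.
pose v := pvert (x : vert (Gamma n k)).
pose l := parrow (Uloop x i : arr (Gamma n k)).
have e : pend v = pstart l by [].
by rewrite /pidem /ploop (path_algebra_mulU e) (pcat1p l).
Qed.

Lemma ploop_pidem x i : ploop x i * pidem x = ploop x i.
Proof.
pose v := pvert (x : vert (Gamma n k)).
pose l := parrow (Uloop x i : arr (Gamma n k)).
have e : pend l = pstart v by [].
by rewrite /pidem /ploop (path_algebra_mulU e) (pcatp1 l).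
Qed.

Definition ploop2 x i j : qpath (Gamma n k) :=
  pcat (parrow (Uloop x i : arr (Gamma n k)))
       (parrow (Uloop x j : arr (Gamma n k))).

Lemma ploopM x i j : ploop x i * ploop x j = delta (ploop2 x i j).
Proof. exact: path_algebra_mulU. Qed.

Lemma label_exprB (a b : PA) : label_expr (a - b) = label_expr a - label_expr b.
Proof. by rewrite /label_expr -scaleN1r linextD linextZ scaleN1r. Qed.

Lemma label_exprU (p : qpath (Gamma n k)) : label_expr (delta p) = delta (path_word p).
Proof. by rewrite /label_expr linext_delta. Qed.

Lemma ploop_relation x i j :
  relations (ploop x i * ploop x j - ploop x j * ploop x i).
Proof.
exists x, x.
rewrite (ploopM x i j).
rewrite (ploopM x j i).
split.
  have W a b : pstart (ploop2 x a b) = x /\ pend (ploop2 x a b) = x.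
    by rewrite pstart_pcat // pend_pcat.
  move=> p /(fsubsetP (msuppB_le _ _)); rewrite !deltaE in_fsetU => /orP[];
    by move=> /(fsubsetP msuppU_le); rewrite in_fset1 => /eqP ->.
rewrite label_exprB !label_exprU.
suff W a b : nc_var (Ul a) * nc_var (Ul b) = delta (path_word (ploop2 x a b)).
  by rewrite -!W; exact: Rel_UU.
rewrite /nc_var !deltaE; apply: etrans (fgmulUU _ _ _ _) _; rewrite mulr1.
congr mkmalgU; apply: val_inj; rewrite /= fmM /path_word /= /parrows.
by rewrite val_pcat.
Qed.

Lemma pi_ploopC x i j : GRing.comm (pi (ploop x i)) (pi (ploop x j)).
Proof.
rewrite /GRing.comm -!rmorphM; apply/quot_piP.
by apply: gen_ideal_gen; exact: ploop_relation.
Qed.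

Lemma pi_pidemC x i : GRing.comm (pi (pidem x)) (pi (ploop x i)).
Proof. by rewrite /GRing.comm -!rmorphM /= pidem_ploop ploop_pidem. Qed.

Lemma comm_bigprodX (A : pzRingType) I (r : seq I) (F : I -> A) (e : I -> nat) u :
  (forall a, GRing.comm u (F a)) -> GRing.comm u (\prod_(a <- r) F a ^+ e a).
Proof. by move=> c; apply: commr_prod => a _; apply: commrX. Qed.

Lemma comm_prodXD (A : pzRingType) I (r : seq I) (F : I -> A) (d e : I -> nat) :
  (forall a b, GRing.comm (F a) (F b)) ->
  \prod_(a <- r) F a ^+ (d a + e a)
    = \prod_(a <- r) F a ^+ d a * \prod_(a <- r) F a ^+ e a.
Proof.
move=> c; elim: r => [|a r IH]; first by rewrite !big_nil mul1r.
rewrite !big_cons IH exprD -!mulrA; congr (_ * _); rewrite !mulrA.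
by congr (_ * _); apply: comm_bigprodX => b; apply: commr_sym; exact: commrX.
Qed.

Lemma pi_loop_monomial x m :
  pi (loop_monomial x m) = pi (pidem x) * \prod_(i < n) pi (ploop x i) ^+ m i.
Proof.
rewrite /loop_monomial rmorphM rmorph_prod; congr (_ * _).
by apply: eq_bigr => i _; rewrite rmorphXn.
Qed.

Lemma pi_loop_monomialM x m1 m2 :
  pi (loop_monomial x (mnm_add m1 m2))
    = pi (loop_monomial x m1) * pi (loop_monomial x m2).
Proof.
rewrite !pi_loop_monomial.
under eq_bigr => i _ do rewrite mnmDE.
rewrite (comm_prodXD _ _ _ (@pi_ploopC x)).
set P := pi _; set A := \prod_(i < n) _; set B := \prod_(i < n) _.
have cPA : GRing.comm P A by apply: comm_bigprodX => i; exact: pi_pidemC.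
have PP : P * P = P by rewrite /P -rmorphM pidem_idem.
by rewrite -[P * A * _]mulrA [A * (P * B)]mulrA -cPA -mulrA !mulrA PP.
Qed.

Lemma pi_loop_monomial0 x : pi (loop_monomial x mnm0) = pi (pidem x).
Proof.
rewrite pi_loop_monomial big1 ?mulr1 // => i _.
by rewrite mnm0E expr0.
Qed.

Lemma pi_loop_monomial_orth x y m1 m2 : x != y ->
  pi (loop_monomial x m1) * pi (loop_monomial y m2) = 0.
Proof.
move=> nxy; rewrite !pi_loop_monomial.
set A := \prod_(i < n) _; set B := \prod_(i < n) _.
have cPA : GRing.comm (pi (pidem x)) A.
  by apply: comm_bigprodX => i; exact: pi_pidemC.
rewrite cPA mulrA -[A * _ * _]mulrA -rmorphM (pidem_orth nxy).
by rewrite rmorph0 mulr0 mul0r.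
Qed.

Lemma loop_eval_seq x (p : Upoly n) (d : seq (multinom n)) :
  uniq d -> {subset mpoly.msupp p <= d} ->
  loop_eval x p = \sum_(m <- d) mpoly.mcoeff m p *: loop_monomial x m.
Proof.
move=> ud sd; rewrite [RHS](bigID (fun m => m \in mpoly.msupp p)) /=.
rewrite [X in _ = _ + X]big1 ?addr0 => [|m /memN_msupp_eq0 ->]; last first.
  by rewrite scale0r.
rewrite -big_filter; apply: perm_big; apply: uniq_perm.
- exact: msupp_uniq.
- exact: filter_uniq.
by move=> m; rewrite mem_filter; apply/idP/andP => [pm|[]//]; split=> //; exact: sd.
Qed.

Lemma loop_evalB x (p q : Upoly n) :
  loop_eval x (p - q) = loop_eval x p - loop_eval x q.
Proof.
pose d := undup (mpoly.msupp p ++ mpoly.msupp q ++ mpoly.msupp (p - q)).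
have ud : uniq d by exact: undup_uniq.
rewrite !(@loop_eval_seq x _ d) //; try by move=> m hm;
  rewrite mem_undup !mem_cat hm ?orbT.
by rewrite -sumrB; apply: eq_bigr => m _; rewrite mpoly.mcoeffB scalerBl.
Qed.

Lemma loop_evalX x m : loop_eval x (mpolyX 'F_2 m) = loop_monomial x m.
Proof. by rewrite /loop_eval mpoly.msuppX big_seq1 mcoeffX eqxx scale1r. Qed.

Lemma Upoly_ind (P : Upoly n -> Prop) :
  P 0 -> (forall p q, P p -> P q -> P (p + q)) ->
  (forall m, P (mpolyX 'F_2 m)) -> forall p, P p.
Proof.
move=> P0 PD PX p; rewrite [p]mpolyE; elim/big_ind: _ => // m _.
have : mpoly.mcoeff m p \in [:: 0; 1 : 'F_2].
  by case: (mpoly.mcoeff m p) => -[|[|]].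
by rewrite !inE => /orP[] /eqP ->; rewrite ?scale0r ?scale1r.
Qed.

Definition pi_eval x (p : Upoly n) : Quiv n k := pi (loop_eval x p).

Lemma pi_eval_is_zmod_morphism x : zmod_morphism (pi_eval x).
Proof. by move=> p q; rewrite /pi_eval loop_evalB rmorphB. Qed.

HB.instance Definition _ x := GRing.isZmodMorphism.Build (Upoly n) (Quiv n k)
  (pi_eval x) (pi_eval_is_zmod_morphism x).

Lemma pi_evalD x (p q : Upoly n) : pi_eval x (p + q) = pi_eval x p + pi_eval x q.
Proof. exact: raddfD. Qed.

Lemma pi_evalX x m : pi_eval x (mpolyX 'F_2 m) = pi (loop_monomial x m).
Proof. by rewrite /pi_eval loop_evalX. Qed.

Lemma pi_evalM x p q : pi_eval x (p * q) = pi_eval x p * pi_eval x q.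
Proof.
elim/Upoly_ind: p => [|p1 p2 I1 I2|m1].
- by rewrite mul0r raddf0 mul0r.
- by rewrite mulrDl !pi_evalD I1 I2 mulrDl.
elim/Upoly_ind: q => [|q1 q2 I1 I2|m2].
- by rewrite mulr0 raddf0 mulr0.
- by rewrite mulrDr !pi_evalD I1 I2 mulrDr.
by rewrite -mpolyXD !pi_evalX pi_loop_monomialM.
Qed.

Lemma pi_eval_orth x y p q : x != y -> pi_eval x p * pi_eval y q = 0.
Proof.
move=> nxy; elim/Upoly_ind: p => [|p1 p2 I1 I2|m1].
- by rewrite raddf0 mul0r.
- by rewrite pi_evalD mulrDl; apply: etrans (congr2 +%R I1 I2) (addr0 _).
elim/Upoly_ind: q => [|q1 q2 I1 I2|m2].
- by rewrite raddf0 mulr0.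
- by rewrite pi_evalD mulrDr; apply: etrans (congr2 +%R I1 I2) (addr0 _).
by rewrite !pi_evalX pi_loop_monomial_orth.
Qed.

Lemma pi_eval1 x : pi_eval x 1 = pi (pidem x).
Proof. by rewrite -mpolyX0 pi_evalX pi_loop_monomial0. Qed.

Lemma Quiv_unitE f : Quiv_unit f = \sum_(x : states n k) pi_eval x (f x).
Proof. by rewrite /Quiv_unit rmorph_sum. Qed.

Lemma Quiv_unit_is_zmod_morphism : zmod_morphism Quiv_unit.
Proof.
move=> f g; rewrite !Quiv_unitE -sumrB; apply: eq_bigr => x _.
by rewrite !ffunE raddfB.
Qed.

Lemma Quiv_unit_is_monoid_morphism : monoid_morphism Quiv_unit.
Proof.
split=> [|f g]; rewrite !Quiv_unitE.
  under eq_bigr => x _ do rewrite ffunE pi_eval1.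
  by rewrite -rmorph_sum.
rewrite mulr_suml; apply: eq_bigr => x _.
rewrite mulr_sumr (bigD1 x) //= big1 ?addr0 => [|y ny].
  by rewrite ffunE pi_evalM.
by rewrite pi_eval_orth // eq_sym.
Qed.

HB.instance Definition _ := GRing.isZmodMorphism.Build (idem_ring n k) (Quiv n k)
  Quiv_unit Quiv_unit_is_zmod_morphism.
HB.instance Definition _ := GRing.isMonoidMorphism.Build (idem_ring n k) (Quiv n k)
  Quiv_unit Quiv_unit_is_monoid_morphism.

(* The values of Quiv_unit on the generators I_x and U_i I_x. *)
Lemma Quiv_unit_single x (p : Upoly n) :
  Quiv_unit [ffun y => if y == x then p else 0] = pi_eval x p.
Proof.
rewrite Quiv_unitE (bigD1 x) //= big1 ?addr0 => [|y /negPf ny]; last first.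
  by rewrite ffunE ny raddf0.
by rewrite ffunE eqxx.
Qed.

Lemma Quiv_unit_idem x :
  Quiv_unit [ffun y => if y == x then 1 else 0] = pi (pidem x).
Proof. by rewrite Quiv_unit_single pi_eval1. Qed.

Lemma Quiv_unit_loop x i :
  Quiv_unit [ffun y => if y == x then Uvar i else 0] = pi (ploop x i).
Proof.
rewrite Quiv_unit_single pi_evalX /loop_monomial.
rewrite (eq_bigr (fun j => if j == i then ploop x j else 1)) => [|j _].
  by rewrite -big_mkcond big_pred1_eq pidem_ploop.
by rewrite mnm1E eq_sym; case: (j == i).
Qed.

End QuivUnit.

(* Main.v *)
From HB Require Import structures.
Require Import Defs.
From mathcomp Require Import all_boot all_order all_algebra.
From mathcomp Require Import boolp finmap zify.
From mathcomp Require Import -(notations) mpoly.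
From mathcomp Require Import monalg.

(* A path from x to y is sent to U^e f_(x,y), where 2 e_i + |v_i(x,y)| is the
   number of letters R_i, L_i in its word plus twice the number of letters U_i;
   since this depends only on the word and the end points, the relations are
   killed. For the inverse, call an arrow labelled R_i (resp. L_i) at x good for
   z if v_i(x,z) > 0 (resp. < 0). Some good arrow leaves x unless x = z, and two
   different good arrows at x have labels of distance > 1, hence complete to a
   commuting square; so all paths of good arrows from x to z have the same class
   gamma_(x,z) in the quotient. An arrow a : x -> y that is not good for z has a
   reverse that is, so a gamma_(y,z) = a a' gamma_(x,z) = U_i gamma_(x,z). Thus
   every path is a U-monomial times some gamma_(x,z), and p f_(x,z) |-> p gamma_(x,z)
   inverts the first map. *)

Set Implicit Arguments.
Unset Strict Implicit.
Unset Printing Implicit Defensive.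

Import Order.TTheory GRing.Theory Num.Theory.

Local Open Scope ring_scope.

(** * Counting elements above a threshold, and numerical data of the labels *)

Section Tail.
Variable n : nat.
Implicit Types (x z : {set 'I_n.+1}) (i : 'I_n).

(** The threshold is any natural number, so that the boundary values at 0 and [n.+1], absent from
    [vdiff], are available. *)
Definition tail x (m : nat) : nat := #|x :&: [set j : 'I_n.+1 | (m <= j)%N]|.

Lemma tail0 x : tail x 0 = #|x|.
Proof.
by rewrite /tail; congr #|pred_of_set _|; apply/setP=> j; rewrite !inE andbT.
Qed.

Lemma tail_max x : tail x n.+1 = 0%N.
Proof.
by apply/eqP; rewrite cards_eq0; apply/eqP/setP=> j; rewrite !inE ltn_geF ?andbF.
Qed.

Lemma tailS x (j : 'I_n.+1) : tail x j = ((j \in x) + tail x j.+1)%N.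
Proof.
rewrite /tail (cardsD1 j) !inE leqnn andbT; congr (_ + _)%N.
congr #|pred_of_set _|; apply/setP=> l.
rewrite !inE ltn_neqAle -!val_eqE /= [l == j :> nat]eq_sym.
by case: (l \in x); rewrite ?andbF ?andbT.
Qed.

(** The two sets agree away from [a] and [b]. The indicators sit on opposite sides so that no
    truncated subtraction occurs. *)
Lemma tail_move x (a b : 'I_n.+1) m : a \in x -> b \notin x ->
  (tail (b |: (x :\ a)) m + (m <= a) = tail x m + (m <= b))%N.
Proof.
move=> ax bx; rewrite /tail; set S := [set _ | _].
rewrite (cardsD1 a (x :&: S)) (cardsD1 b (_ :&: S)) !inE ax eqxx /=.
suff -> : ((b |: (x :\ a)) :&: S) :\ b = (x :&: S) :\ a.
  by rewrite addnC addnA addnAC.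
apply/setP=> j; rewrite !inE; have [->|_] /= := eqVneq j b.
  by rewrite (negPf bx) andbF.
by rewrite andbA.
Qed.

(* lfrom and lto are junk on the loops Ul i. *)
Definition lfrom (l : label n) : 'I_n.+1 :=
  match l with Rl i => prv i | Ll i => nxt i | Ul i => prv i end.
Definition lto (l : label n) : 'I_n.+1 :=
  match l with Rl i => nxt i | Ll i => prv i | Ul i => prv i end.
Definition lidx (l : label n) : 'I_n := match l with Rl i | Ll i | Ul i => i end.
(** The change in [v] at the index of the letter. The hypothesis [lsgn l != 0] will say that [l] is
    an R or an L. *)
Definition lsgn (l : label n) : int :=
  match l with Rl _ => 1 | Ll _ => -1 | Ul _ => 0 end.
Definition lrev (l : label n) : label n :=
  match l with Rl i => Ll i | Ll i => Rl i | Ul i => Ul i end.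
End Tail.

(** * Combinatorics of single arrows: good arrows and commuting squares *)

Section Moves.
Variables n k : nat.
Implicit Types (x y z : states n k) (l : label n) (i : 'I_n).
Local Notation arrow := (arrow n k).

Lemma is_arrowE x l y : lsgn l != 0 -> is_arrow x l y =
  [&& lfrom l \in val x, lto l \notin val x
    & val y == lto l |: (val x :\ lfrom l)].
Proof. by case: l. Qed.

Lemma vdiffE x y i : vdiff x y i = (tail (val y) i.+1)%:Z - (tail (val x) i.+1)%:Z.
Proof. by []. Qed.

Lemma vdiffD x y z i : vdiff x z i = vdiff x y i + vdiff y z i.
Proof. by rewrite /vdiff; lia. Qed.

Lemma vdiff_arrow x l y i : is_arrow x l y ->
  vdiff x y i = if i == lidx l then lsgn l else 0.
Proof.
have [l0|l0] := eqVneq (lsgn l) 0.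
  by rewrite l0 if_same; case: l l0 => // j _ /eqP ->; rewrite /vdiff subrr.
rewrite is_arrowE // => /and3P[fx tx /eqP ey].
have := tail_move i.+1 fx tx; rewrite -ey vdiffE.
move: l l0 {fx tx ey} => [j|j|//] _ /=; rewrite -val_eqE /= /bump /= add1n ltnS;
  move: (tail _ _) (tail _ _) => a b; case: ltngtP => _ /=;
  rewrite ?addn0 ?addn1; lia.
Qed.

Lemma move_card x (a b : 'I_n.+1) : a \in val x -> b \notin val x ->
  #|b |: (val x :\ a)| == k.
Proof.
move=> ax bx; have := tail_move 0 ax bx; rewrite !tail0 (eqP (valP x)) /=.
by move/eqP; rewrite eqn_add2r.
Qed.

Lemma arrow_exists x l : lsgn l != 0 -> lfrom l \in val x ->
  lto l \notin val x -> exists y, is_arrow x l y.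
Proof.
move=> l0 fx tx.
exists (exist (fun y : {set 'I_n.+1} => #|y| == k) _ (move_card fx tx)).
by rewrite is_arrowE // fx tx /= eqxx.
Qed.

Lemma lfromto_neq l : lsgn l != 0 -> lfrom l != lto l.
Proof. by case: l => // i _; rewrite -val_eqE /= /bump /=; lia. Qed.

Lemma is_arrow_rev x l y : is_arrow x l y -> is_arrow y (lrev l) x.
Proof.
have [l0|l0] := eqVneq (lsgn l) 0; first by case: l l0 => //= i _; rewrite eq_sym.
rewrite is_arrowE // => /and3P[fx tx /eqP ey].
have r0 : lsgn (lrev l) != 0 by case: (l) l0.
have [ef et] : lfrom (lrev l) = lto l /\ lto (lrev l) = lfrom l.
  by case: (l) l0.
rewrite is_arrowE // ef et ey !inE !eqxx (negPf (lfromto_neq l0)) /=.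
apply/eqP/setP=> j; rewrite !inE.
have [->|jf] := eqVneq j (lfrom l); first by rewrite fx.
by have [->|_] := eqVneq j (lto l); first by rewrite (negPf tx).
Qed.

Definition good z x l := 0 < lsgn l * vdiff x z (lidx l).

Lemma good_move z x l : good z x l -> lsgn l != 0.
Proof. by apply: contraTneq => e; rewrite /good e mul0r. Qed.

Definition dist x z : nat := \sum_(i < n) absv x z i.

Lemma dist_good z x l y : is_arrow x l y -> good z x l -> (dist y z < dist x z)%N.
Proof.
move=> a g; rewrite /dist (bigD1 (lidx l)) // [ltnRHS](bigD1 (lidx l)) //=.
rewrite (eq_bigr (absv x z)) => [|i ne]; last first.
  by rewrite /absv (vdiffD x y) (vdiff_arrow i a) (negPf ne) add0r.
rewrite ltn_add2r /absv; move: g; rewrite /good (vdiffD x y) (vdiff_arrow _ a) eqxx.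
by case: (l) => i /=; lia.
Qed.

(** Here [bx] and [bz] stand for the indicators of two states and [D] for their tail difference.
    Going down from a positive value to [D 0 = 0], the difference must drop, which happens only at a
    point of [bx]. The largest [j] in [bx] with [D j.+1 > 0] works: if [j.+1] were in [bx] too,
    [D j.+2] would still be positive. *)
Lemma ascent_step (bx bz : nat -> bool) (D : nat -> int) :
  D 0%N = 0 -> D n.+1 = 0 ->
  (forall m, (m <= n)%N -> D m = D m.+1 + (bz m)%:Z - (bx m)%:Z) ->
  forall m, (m <= n.+1)%N -> 0 < D m ->
  exists j, [/\ (j < n)%N, bx j, ~~ bx j.+1 & 0 < D j.+1].
Proof.
move=> D0 Dn DS m mn Dm.
have [||j] := @ex_maxnP (fun j => [&& (j <= n)%N, bx j & 0 < D j.+1]) n.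
- elim: m mn Dm => [|m IH] mn Dm; first by rewrite D0 in Dm.
  case: (lerP (D m) 0) => Dm'; last by apply: IH => //; apply: ltnW.
  exists m; rewrite Dm andbT -ltnS mn /=; have := DS m mn.
  by case: (bx m) => //; case: (bz m) => /=; lia.
- by move=> j /and3P[].
move=> /and3P[jn bj Dj] jmax.
have {}jn : (j < n)%N.
  by rewrite ltn_neqAle jn andbT; apply: contraTneq Dj => ->; rewrite Dn.
exists j; split=> //; apply/negP => bj1.
suff : (j.+1 <= j)%N by rewrite ltnn.
apply: jmax; rewrite jn bj1 /=.
by have := DS j.+1 jn; rewrite bj1; case: (bz _) => /=; lia.
Qed.

(** The reflection of [0,n] that sends [a] to [n - a], combined with a change of sign of [D],
    reduces this to [ascent_step]. *)
Lemma descent_step (bx bz : nat -> bool) (D : nat -> int) :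
  D 0%N = 0 -> D n.+1 = 0 ->
  (forall m, (m <= n)%N -> D m = D m.+1 + (bz m)%:Z - (bx m)%:Z) ->
  forall m, (m <= n.+1)%N -> D m < 0 ->
  exists j, [/\ (j < n)%N, ~~ bx j, bx j.+1 & D j.+1 < 0].
Proof.
move=> D0 Dn DS m mn Dm.
have [|||||j [jn b1 b2 Dj]] := @ascent_step (fun a => bx (n - a)%N)
    (fun a => bz (n - a)%N) (fun a => - D (n.+1 - a)%N) _ _ _ (n.+1 - m)%N.
- by rewrite subn0 Dn.
- by rewrite subnn D0.
- move=> a an; have := DS (n - a)%N (leq_subr _ _).
  by rewrite subSS -(subSn an); lia.
- exact: leq_subr.
- by rewrite subKn //; lia.
exists (n - j.+1)%N; rewrite -subSn // subSS in b1 Dj *.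
by split=> //; lia.
Qed.

Lemma good_arrow x z : x != z -> exists l y, is_arrow x l y /\ good z x l.
Proof.
move=> nxz.
pose b (y : states n k) m := inord m \in val y.
pose D m : int := (tail (val z) m)%:Z - (tail (val x) m)%:Z.
have D0 : D 0%N = 0 by rewrite /D !tail0 (eqP (valP x)) (eqP (valP z)) subrr.
have Dn : D n.+1 = 0 by rewrite /D !tail_max.
have DS m : (m <= n)%N -> D m = D m.+1 + (b z m)%:Z - (b x m)%:Z.
  move=> mn; rewrite /D /b; have := tailS (val x) (inord m).
  have := tailS (val z) (inord m); rewrite inordK // => -> ->.
  rewrite !PoszD; move: (_ \in val z) (_ \in val x) (tail _ _) (tail _ _) => *; lia.
have prvE (j : 'I_n) : inord j = prv j.
  by apply: val_inj; rewrite /= inordK // ltnS ltnW.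
have nxtE (j : 'I_n) : inord j.+1 = nxt j.
  by apply: val_inj; rewrite /= /bump inordK // ltnS.
(* If every difference vanishes, the recursion [DS] shows that both states contain the same
   points. *)
have [[m [mn Dm]]|nD] := pselect (exists m, (m <= n.+1)%N /\ D m != 0); last first.
  case/eqP: nxz; apply/val_inj/setP=> j.
  have jn : (j <= n)%N by rewrite -ltnS.
  have := DS j jn.
  have Dz a : (a <= n.+1)%N -> D a = 0.
    by move=> le; apply/eqP/negP => /negP ne; apply: nD; exists a.
  rewrite (Dz j.+1) // (Dz j (leqW jn)) /b inord_val.
  by case: (_ \in _); case: (_ \in _).
case: (ltrgtP (D m) 0) Dm => // Dm _.
- have [j [jn b1 b2 Dj]] := descent_step D0 Dn DS mn Dm.
  pose l := Ll (Ordinal jn).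
  have [||y a] := @arrow_exists x l isT; rewrite /= -?nxtE -?prvE //.
  by exists l, y; split=> //; rewrite /good /= mulN1r oppr_gt0.
- have [j [jn b1 b2 Dj]] := ascent_step D0 Dn DS mn Dm.
  pose l := Rl (Ordinal jn).
  have [||y a] := @arrow_exists x l isT; rewrite /= -?nxtE -?prvE //.
  by exists l, y; split=> //; rewrite /good /= mul1r.
Qed.

Lemma vdiff_next x z i (j : 'I_n) : j = i.+1 :> nat ->
  vdiff x z i = vdiff x z j + (nxt i \in val z)%:Z - (nxt i \in val x)%:Z.
Proof.
move=> e; rewrite !vdiffE e; have := tailS (val x) (nxt i).
have := tailS (val z) (nxt i); rewrite /= /bump /= add1n => -> ->.
by rewrite !PoszD; move: (_ \in val z) (_ \in val x) (tail _ _) (tail _ _) => *; lia.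
Qed.

(** Equal indices, or the same letter at adjacent indices, put contradictory membership conditions
    on a point of [x]. For an R and an L at adjacent indices, goodness asks for opposite signs of
    [v] at [i] and [i+1]; by [vdiff_next] these values differ by at most one, in the direction that
    membership of [nxt i] in [x] makes incompatible with those signs. *)
Lemma good_far z x l m y y' : is_arrow x l y -> good z x l ->
  is_arrow x m y' -> good z x m -> l != m -> (1 < `|lidx l - lidx m|)%N.
Proof.
wlog lm : l m y y' / (lidx l <= lidx m)%N.
  move=> W al gl am gm ne; case/orP: (leq_total (lidx l) (lidx m)) => le.
    exact: (W l m y y').
  by rewrite distnC; apply: (W m l y' y) => //; rewrite eq_sym.
move=> al gl am gm ne; rewrite ltnNge; apply/negP => le.
have [l0 m0] := (good_move gl, good_move gm).
rewrite !is_arrowE // in al am.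
case/and3P: al am => fl tl _ /and3P[fm tm _].
have [e|ne'] := eqVneq (lidx l) (lidx m).
  by case: l m l0 m0 ne e gl gm {lm le} fl tl fm tm => [i|i|//] [j|j|//] _ _ + /= e;
    rewrite e ?eqxx // => _ _ _ f1 t1 f2 t2; rewrite ?(f1,f2) in t1 t2.
have {lm le ne'} e : lidx m = (lidx l).+1 :> nat.
  by rewrite -val_eqE /= in ne'; lia.
have en : prv (lidx m) = nxt (lidx l) by apply: val_inj; rewrite /= e.
have := vdiff_next x z e; move: gl gm; rewrite /good.
case: l m l0 m0 e en {ne} fl tl fm tm => [i|i|//] [j|j|//] _ _ /= e -> f1 t1 f2 t2;
 rewrite ?(f1, f2) in t1 t2 *; case: (_ \in val z) => //=; lia.
Qed.

Lemma far_disjoint l m : lsgn l != 0 -> lsgn m != 0 ->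
  (1 < `|lidx l - lidx m|)%N ->
  [/\ lfrom l != lfrom m, lfrom l != lto m, lto l != lfrom m & lto l != lto m].
Proof.
by case: l => [i|i|//] _; case: m => [j|j|//] _ /= h; rewrite -!val_eqE /= /bump /=;
  split; lia.
Qed.

(** Distant labels move elements between disjoint pairs of positions, so neither move obstructs the
    other and their order is irrelevant. *)
Lemma diamond x l y m y' : lsgn l != 0 -> lsgn m != 0 ->
  (1 < `|lidx l - lidx m|)%N -> is_arrow x l y -> is_arrow x m y' ->
  exists w, is_arrow y m w /\ is_arrow y' l w.
Proof.
move=> l0 m0 lm; have [ff ft tf tt] := far_disjoint l0 m0 lm.
rewrite !is_arrowE // => /and3P[fl tl /eqP ey] /and3P[fm tm /eqP ey'].
have fy : lfrom m \in val y by rewrite ey !inE fm [_ == lfrom l]eq_sym ff orbT.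
have ty : lto m \notin val y.
  by rewrite ey !inE (negPf tm) andbF orbF eq_sym.
have [w aw] := arrow_exists m0 fy ty; exists w; split=> //.
move: aw; rewrite !is_arrowE // => /and3P[_ _ /eqP ->].
rewrite ey ey' !inE fl ff (negPf tl) (negPf tt) andbF orbF orbT /=.
apply/eqP/setP=> j; rewrite !inE.
have [->|_] /= := eqVneq j (lto m); first by rewrite [_ == lfrom l]eq_sym ft orbT.
have [->|_] /= := eqVneq j (lto l); first by rewrite tf.
by rewrite andbCA.
Qed.

End Moves.

(** * Classes of arrows and geodesics in the quotient *)

Section Geodesics.
Variables n k : nat.
Implicit Types (x y z : states n k) (l m : label n) (i j : 'I_n).
Local Notation arrow := (arrow n k).
Local Notation PA := (path_algebra (Gamma n k) 'F_2).
Local Notation pi := (@quot_pi PA (@relations n k)).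

Definition arrow_of x l y (h : is_arrow x l y) : arrow :=
  exist (fun a => is_arrow a.1.1 a.1.2 a.2) (x, l, y) h.

Definition aclass (a : arrow) : Quiv n k :=
  pi (delta (parrow (a : arr (Gamma n k)))).

Lemma pi_rel (p q : qpath (Gamma n k)) : pstart p = pstart q -> pend p = pend q ->
  rel_expr (delta (path_word p) - delta (path_word q)) ->
  pi (delta p) = pi (delta q).
Proof.
move=> es ee r; apply/quot_piP; apply: gen_ideal_gen; exists (pstart p), (pend p).
split=> [t /(fsubsetP (msuppB_le _ _))|].
  rewrite !deltaE in_fsetU => /orP[];
    by move=> /(fsubsetP msuppU_le); rewrite in_fset1 => /eqP ->.
by rewrite label_exprB !label_exprU.
Qed.

Lemma nc_varM l m : nc_var l * nc_var m = delta (FMonom [:: l; m]).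
Proof.
rewrite /nc_var !deltaE; apply: etrans (fgmulUU _ _ _ _) _; rewrite mulr1.
by congr mkmalgU; apply: val_inj; rewrite /= fmM.
Qed.

Definition path2 (a b : arrow) : qpath (Gamma n k) :=
  pcat (parrow (a : arr (Gamma n k))) (parrow (b : arr (Gamma n k))).

Section TwoArrows.
Variables (a b : arrow).
Hypothesis ab : arrow_tgt a = arrow_src b.

Lemma aclassM : aclass a * aclass b = pi (delta (path2 a b)).
Proof. by rewrite /aclass -rmorphM path_algebra_mulU. Qed.

Lemma pstart_path2 : pstart (path2 a b) = arrow_src a.
Proof. by rewrite pstart_pcat. Qed.

Lemma pend_path2 : pend (path2 a b) = arrow_tgt b.
Proof. by rewrite pend_pcat. Qed.

Lemma path2_word :
  delta (path_word (path2 a b)) = nc_var (arrow_label a) * nc_var (arrow_label b).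
Proof. by rewrite nc_varM /path_word /parrows val_pcat. Qed.

End TwoArrows.

Definition path2E := (pstart_path2, pend_path2, path2_word).

Lemma aclass_square x l y m w l' y' m' (h1 : is_arrow x l y) (h2 : is_arrow y m w)
    (h3 : is_arrow x l' y') (h4 : is_arrow y' m' w) :
  rel_expr (nc_var l * nc_var m - nc_var l' * nc_var m') ->
  aclass (arrow_of h1) * aclass (arrow_of h2) =
  aclass (arrow_of h3) * aclass (arrow_of h4).
Proof. by move=> r; rewrite !aclassM //; apply: pi_rel; rewrite !path2E. Qed.

Lemma aclass_triangle x l y m w l' (h1 : is_arrow x l y) (h2 : is_arrow y m w)
    (h3 : is_arrow x l' w) :
  rel_expr (nc_var l * nc_var m - nc_var l') ->
  aclass (arrow_of h1) * aclass (arrow_of h2) =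
  aclass (arrow_of h3).
Proof. by move=> r; rewrite !aclassM //; apply: pi_rel; rewrite !path2E. Qed.

Lemma is_arrow_loop x i : is_arrow x (Ul i) x. Proof. exact: eqxx. Qed.

Lemma ploopE x i : pi (ploop x i) = aclass (arrow_of (is_arrow_loop x i)).
Proof.
by rewrite /aclass /ploop (bool_irrelevance (is_arrow_loop x i) (eqxx x)).
Qed.

Lemma aclass_loop x l y (h : is_arrow x l y) i :
  aclass (arrow_of h) * pi (ploop y i) = pi (ploop x i) * aclass (arrow_of h).
Proof.
rewrite !ploopE; apply: aclass_square.
by case: l {h} => [j|j|j]; [exact: Rel_RU|exact: Rel_LU|exact: Rel_UU].
Qed.

Lemma aclass_rev x l y (h : is_arrow x l y) : lsgn l != 0 ->
  aclass (arrow_of h) * aclass (arrow_of (is_arrow_rev h)) = pi (ploop x (lidx l)).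
Proof.
move=> l0; rewrite ploopE; apply: aclass_triangle.
by case: (l) l0 => // i _; [exact: Rel_RL|exact: Rel_LR].
Qed.

Lemma aclass_diamond x l y m y' w (h1 : is_arrow x l y) (h2 : is_arrow y m w)
    (h3 : is_arrow x m y') (h4 : is_arrow y' l w) :
  lsgn l != 0 -> lsgn m != 0 -> (1 < `|lidx l - lidx m|)%N ->
  aclass (arrow_of h1) * aclass (arrow_of h2) =
  aclass (arrow_of h3) * aclass (arrow_of h4).
Proof.
case: l h1 h4 => [i|i|//]; case: m h2 h3 => [j|j|//] h2 h3 h1 h4 _ _ d.
- by apply: aclass_square; exact: Rel_RRC.
- by apply: aclass_square; exact: Rel_RLC.
(* The mixed relation is given only with the R letter first in its leading term, so here it is read
   backwards with the indices exchanged. *)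
- by symmetry; apply: aclass_square; apply: Rel_RLC; rewrite distnC.
- by apply: aclass_square; exact: Rel_LLC.
Qed.

Lemma idem_aclass x l y (h : is_arrow x l y) :
  pi (pidem x) * aclass (arrow_of h) = aclass (arrow_of h).
Proof.
pose v := pvert (x : vert (Gamma n k)).
pose p := parrow (arrow_of h : arr (Gamma n k)).
have e : pend v = pstart p by [].
by rewrite /aclass -rmorphM /= /pidem (path_algebra_mulU e) (pcat1p p).
Qed.

Lemma aclass_idem x l y (h : is_arrow x l y) :
  aclass (arrow_of h) * pi (pidem y) = aclass (arrow_of h).
Proof.
pose v := pvert (y : vert (Gamma n k)).
pose p := parrow (arrow_of h : arr (Gamma n k)).
have e : pend p = pstart v by [].
by rewrite /aclass -rmorphM /= /pidem (path_algebra_mulU e) (pcatp1 p).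
Qed.

(** This is centrality of the variables: relations (1) slide loops past an arrow one at a time. *)
Lemma aclass_eval x l y (h : is_arrow x l y) (p : Upoly n) :
  aclass (arrow_of h) * pi_eval y p = pi_eval x p * aclass (arrow_of h).
Proof.
elim/Upoly_ind: p => [|p1 p2 I1 I2|m]; first by rewrite !raddf0 mulr0 mul0r.
  by rewrite (pi_evalD x) (pi_evalD y) mulrDr [RHS]mulrDl; apply: congr2.
rewrite !pi_evalX !pi_loop_monomial mulrA aclass_idem.
have cA : GRing.comm (pi (pidem x)) (\prod_(i < n) pi (ploop x i) ^+ m i).
  by apply: comm_bigprodX => i; exact: pi_pidemC.
(* The idempotents at both ends are absorbed by the arrow; only the products of loops remain to be
   compared. *)
rewrite cA -mulrA idem_aclass.
elim/big_rec2: _ => [|i P Q _ IH]; first by rewrite mulr1 mul1r.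
rewrite mulrA -[RHS]mulrA -IH mulrA; congr (_ * _).
elim: (m i) => [|e IHe]; first by rewrite !expr0 mulr1 mul1r.
by rewrite !exprS mulrA aclass_loop -!mulrA IHe.
Qed.

Lemma pi_eval_loop x i : pi_eval x (Uvar i) = pi (ploop x i).
Proof. by rewrite -Quiv_unit_single Quiv_unit_loop. Qed.

Fixpoint geodesic z x (s : seq arrow) : bool :=
  if s is a :: s' then
    [&& arrow_src a == x, good z x (arrow_label a) & geodesic z (arrow_tgt a) s']
  else x == z.

Definition arrows_class z (s : seq arrow) : Quiv n k :=
  foldr (fun a u => aclass a * u) (pi (pidem z)) s.

Lemma geodesic_exists x z : exists s, geodesic z x s.
Proof.
have [d] := ubnP (dist x z); elim: d x => // d IH x lt.
have [->|nxz] := eqVneq x z; first by exists [::] => /=.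
have [l [y [h g]]] := good_arrow nxz.
have [s gs] := IH y (leq_trans (dist_good h g) lt).
by exists (arrow_of h :: s); rewrite /= eqxx g.
Qed.

Lemma good_refl z l : good z z l = false.
Proof. by rewrite /good /vdiff subrr mulr0 ltxx. Qed.

Lemma is_arrow_inj x l y y' : is_arrow x l y -> is_arrow x l y' -> y = y'.
Proof.
case: l => [i|i|i] /=; last (by move=> /eqP -> /eqP ->);
  move=> /and3P[_ _ /eqP e1] /and3P[_ _ /eqP e2]; apply: val_inj;
  exact: etrans e1 (esym e2).
Qed.

Lemma good_step z x l y m : is_arrow x l y -> lidx m != lidx l ->
  good z x m -> good z y m.
Proof.
by move=> h ne; rewrite /good (vdiffD x y) (vdiff_arrow _ h) (negPf ne) add0r.
Qed.

(* Newman's argument: two distinct steps towards z have distant labels, so they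
   close up to a commuting square, and dist x z decreases along each step. *)
Lemma geodesic_class z x s t : geodesic z x s -> geodesic z x t ->
  arrows_class z s = arrows_class z t.
Proof.
have [d] := ubnP (dist x z); elim: d x s t => // d IH x [|a s] [|b t] lt //=.
- by move=> /eqP -> /and3P[_]; rewrite good_refl.
- by move=> + /eqP e; rewrite e => /and3P[_]; rewrite good_refl.
case: a b => [[[x1 l] y] h] [[[x2 m] y'] h']; rewrite /arrow_src /arrow_label.
rewrite /arrow_tgt /= in h h' *; move=> /and3P[/eqP ex g gs] /and3P[/eqP ex' g' gt].
subst x1 x2; have lty := leq_trans (dist_good h g) lt.
have lty' := leq_trans (dist_good h' g') lt.
have [elm|nlm] := eqVneq l m.
  subst m; have ey := is_arrow_inj h h'; subst y'.
  by rewrite (bool_irrelevance h h') (IH y s t).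
have far := good_far h g h' g' nlm.
have [l0 m0] := (good_move g, good_move g').
have nlm' : lidx l != lidx m by apply: contraTneq far => ->; rewrite distnn.
have [w [h1 h2]] := diamond l0 m0 far h h'.
have [r gr] := geodesic_exists w z.
have gm : good z y m by apply: (good_step h) => //; rewrite eq_sym.
have gl : good z y' l by apply: (good_step h').
rewrite (IH y s (arrow_of h1 :: r)) //; last by rewrite /= eqxx gm.
rewrite (IH y' t (arrow_of h2 :: r)) //; last by rewrite /= eqxx gl.
by rewrite /= !mulrA (aclass_diamond h h1 h' h2).
Qed.

(** This is gamma_(x,z); [gclassE] shows that the chosen geodesic does not matter. *)
Definition gclass x z : Quiv n k := arrows_class z (xchoose (geodesic_exists x z)).

Lemma gclassE z x s : geodesic z x s -> gclass x z = arrows_class z s.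
Proof. by apply: geodesic_class; exact: (xchooseP (geodesic_exists x z)). Qed.

Lemma gclass_refl x : gclass x x = pi (pidem x).
Proof. by rewrite (@gclassE x x [::]) /=. Qed.

Lemma idem_gclass x z : pi (pidem x) * gclass x z = gclass x z.
Proof.
have [[|[[[x' l] y] h] s]] := geodesic_exists x z => g; rewrite (gclassE g) /=.
  by move: g => /= /eqP ->; rewrite -rmorphM pidem_idem.
by case/and3P: g => /eqP <- _ _; rewrite mulrA idem_aclass.
Qed.

Lemma aclass_good z x l y (h : is_arrow x l y) : good z x l ->
  aclass (arrow_of h) * gclass y z = gclass x z.
Proof.
move=> g; rewrite (@gclassE z x (arrow_of h :: xchoose (geodesic_exists y z))) //=.
by rewrite eqxx g (xchooseP (geodesic_exists y z)).
Qed.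

(** Only the index of [l] contributes. There a good step shortens |v| by one, so the triangle
    inequality is an equality and the exponent is 0; any other step lengthens |v| by one, and the
    exponent is (1+1)/2. *)
Lemma Umon_arrow x l y z : is_arrow x l y -> lsgn l != 0 ->
  Umon x y z = if good z x l then 1 else Uvar (lidx l).
Proof.
move=> h l0; rewrite /Umon (bigD1 (lidx l)) //= big1 ?mulr1 => [|i ne]; last first.
  rewrite /Uexp /absv (vdiffD x y z) (vdiff_arrow _ h) (negPf ne) add0r addn0 subnn.
  exact: expr0.
suff -> : Uexp x y z (lidx l) = ~~ good z x l by case: good.
rewrite /Uexp /good /absv (vdiffD x y z) (vdiff_arrow _ h) eqxx.
by case: (l) l0 => //= i _; lia.
Qed.

(** The counterpart in the quotient of the product f_(x,y) f_(y,z) in [B0]. *)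
Lemma aclass_gclass x l y z (h : is_arrow x l y) : lsgn l != 0 ->
  aclass (arrow_of h) * gclass y z = pi_eval x (Umon x y z) * gclass x z.
Proof.
move=> l0; rewrite (Umon_arrow _ h) //; case: ifP => g.
  by rewrite aclass_good // pi_eval1 idem_gclass.
(* The reverse arrow is good at [y], so gamma_(y,z) factors through it, and the arrow followed by
   its reverse is a loop U. *)
rewrite -(@aclass_good z _ _ _ (is_arrow_rev h)) ?mulrA ?aclass_rev ?pi_eval_loop //.
move: g; rewrite /good (vdiffD x y z) (vdiff_arrow _ h).
by case: (l) l0 => //= i _; rewrite eqxx; lia.
Qed.

End Geodesics.

(** * Ring homomorphisms out of a quotient *)

Section QuotientLift.
Variables (A B : pzRingType) (S : A -> Prop) (f : {rmorphism A -> B}).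
Hypothesis fS : forall s, S s -> f s = 0.

Lemma gen_ideal_ker a : gen_ideal S a -> f a = 0.
Proof.
move=> /(_ (fun a => f a = 0)); apply=> //.
split=> [|u v fu fv|c u fu]; first exact: rmorph0.
  by rewrite rmorphB fu fv subrr.
by rewrite !rmorphM fu mulr0 mul0r.
Qed.

Definition quot_lift (u : quotient_ring S) : B := f (repr u).

Lemma quot_lift_pi a : quot_lift (quot_pi S a) = f a.
Proof.
apply/eqP; rewrite -subr_eq0 /quot_lift -rmorphB; apply/eqP.
by apply: gen_ideal_ker; exact: repr_pi.
Qed.

Lemma quot_lift_is_zmod_morphism : zmod_morphism quot_lift.
Proof.
move=> u v; have [a ->] := quot_surj u; have [b ->] := quot_surj v.
by rewrite -rmorphB !quot_lift_pi rmorphB.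
Qed.

Lemma quot_lift_is_monoid_morphism : monoid_morphism quot_lift.
Proof.
split=> [|u v]; first by rewrite -(rmorph1 (quot_pi S)) quot_lift_pi rmorph1.
have [a ->] := quot_surj u; have [b ->] := quot_surj v.
by rewrite -rmorphM !quot_lift_pi rmorphM.
Qed.

End QuotientLift.

(** * The homomorphism from the quiver algebra to [B0] *)

Section ToB0.
Variables n k : nat.
Implicit Types (x y z : states n k) (l m : label n) (i j : 'I_n).
Local Notation arrow := (arrow n k).
Local Notation PA := (path_algebra (Gamma n k) 'F_2).
Local Notation pi := (@quot_pi PA (@relations n k)).
Local Notation path := (qpath (Gamma n k)).

(* B0 with its scalars restricted to F_2, so that linext can take values in it. *)
Definition B0F2 : Type := B0 n k.
HB.instance Definition _ := GRing.PzRing.copy B0F2 (B0 n k).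

Definition B0F2_scale (c : 'F_2) (v : B0F2) : B0F2 :=
  (mpolyC n c *: (v : B0 n k)).

Lemma B0F2_scaleA c d v : B0F2_scale c (B0F2_scale d v) = B0F2_scale (c * d) v.
Proof. by rewrite /B0F2_scale scalerA -mpoly.mpolyCM. Qed.
Lemma B0F2_scale1 : left_id 1 B0F2_scale.
Proof. by move=> v; rewrite /B0F2_scale mpoly.mpolyC1 scale1r. Qed.
Lemma B0F2_scaleDr : right_distributive B0F2_scale +%R.
Proof. by move=> c u v; apply: scalerDr. Qed.
Lemma B0F2_scaleDl v : {morph B0F2_scale^~ v : c d / c + d}.
Proof. by move=> c d; rewrite /B0F2_scale mpoly.mpolyCD; apply: scalerDl. Qed.
HB.instance Definition _ := GRing.Zmodule_isLmodule.Build 'F_2 B0F2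
  B0F2_scaleA B0F2_scale1 B0F2_scaleDr B0F2_scaleDl.

(** Costs are twice the powers of U, so that a single R or L can be counted as half a U. *)
Definition cost l i : nat :=
  if i == lidx l then (if lsgn l == 0 then 2 else 1) else 0.

Definition wcost (w : seq (label n)) i : nat := \sum_(l <- w) cost l i.

(** Subtraction and halving are exact when [w] is the word of a path from [x] to [y], by
    [wexp_path]. *)
Definition wexp x y (w : seq (label n)) i : nat := (wcost w i - absv x y i)./2.

Definition wmon x y (w : seq (label n)) : Upoly n :=
  \prod_(i < n) Uvar i ^+ wexp x y w i.

Definition fbasis x y : B0 n k := delta (x, y).

(** The ends are separate arguments: for fixed [x] and [y] this extends linearly to all
    noncommutative polynomials, so relations can be evaluated on their labels alone. *)
Definition word_value x y (w : {fmonom (label n)}) : B0F2 :=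
  wmon x y w *: fbasis x y.

Definition path_value (p : path) : B0F2 :=
  word_value (pstart p) (pend p) (path_word p).

Lemma wcost_cat w1 w2 i : wcost (w1 ++ w2) i = (wcost w1 i + wcost w2 i)%N.
Proof. exact: big_cat. Qed.

(** The cost exceeds |v_i| between the ends by an even number: at its index, a prepended R or L
    changes both by one, and a loop changes only the cost, by two. *)
Lemma wexp_walk x (s : seq arrow) i : @walk (Gamma n k) x s ->
  let y := last x [seq arrow_tgt a | a <- s] in
  let w := [seq arrow_label a | a <- s] in
  ((wexp x y w i).*2 + absv x y i = wcost w i)%N.
Proof.
rewrite /wexp => ws /=; suff [e ->] : exists e, wcost [seq arrow_label a | a <- s] i
   = (e.*2 + absv x (last x [seq arrow_tgt a | a <- s]) i)%N.
  by rewrite addnK doubleK.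
elim: s x ws => [|[[[x' l] y] h] s IH] x /=.
  by exists 0%N; rewrite /wcost big_nil /absv /vdiff subrr.
rewrite {1}/arrow_src /= => /andP[/eqP <- {x}] /IH[e]; rewrite /arrow_tgt /=.
rewrite /wcost big_cons /arrow_label /= => ->; set z := last _ _.
rewrite /= in h; rewrite /absv (vdiffD x' y z) (vdiff_arrow _ h) /cost.
case: (i == lidx l); last by exists e; rewrite add0r.
case: l {h} => [j|j|j] /=; last by exists e.+1; lia.
  (* The half-excess [e] is unchanged exactly when the prepended step is good for the end [z]. For R
     this means that v_i(y,z) is nonnegative, for L that it is nonpositive. *)
  by exists (if (0 <= vdiff y z i)%R then e else e.+1); case: ifP; lia.
by exists (if (vdiff y z i <= 0)%R then e else e.+1); case: ifP; lia.
Qed.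

Lemma wexp_path (p : path) i :
  ((wexp (pstart p) (pend p) (path_word p) i).*2 + absv (pstart p) (pend p) i
   = wcost (path_word p) i)%N.
Proof. case: p => [[x s] ws]; exact: (wexp_walk i ws). Qed.

Lemma B0_mulZ (c d : Upoly n) (u v : B0 n k) :
  (c *: u) * (d *: v) = (c * d) *: (u * v).
Proof.
by apply: etrans (bilinextZl _ _ _ _) _; rewrite -scalerA; congr (_ *: _);
  exact: bilinextZr.
Qed.

Lemma B0F2_mulZ (c d : 'F_2) (u v : B0F2) :
  (c *: u) * (d *: v) = (c * d) *: (u * v).
Proof.
by apply: etrans (B0_mulZ _ _ _ _) _; rewrite -mpoly.mpolyCM.
Qed.

Lemma path_algebra_mulZ (c d : 'F_2) (a b : PA) :
  (c *: a) * (d *: b) = (c * d) *: (a * b).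
Proof.
by apply: etrans (bilinextZl _ _ _ _) _; rewrite -scalerA; congr (_ *: _);
  exact: bilinextZr.
Qed.

Lemma fbasisM x y z : fbasis x y * fbasis y z = Umon x y z *: fbasis x z.
Proof. exact: B0_deltaM. Qed.

Lemma fbasisZM (c d : Upoly n) x y z :
  (c *: fbasis x y) * (d *: fbasis y z) = (c * d * Umon x y z) *: fbasis x z.
Proof.
by apply: etrans (B0_mulZ _ _ _ _) _; rewrite -[RHS]scalerA fbasisM.
Qed.

Lemma fbasisZM0 (c d : Upoly n) x y y' z : y != y' ->
  (c *: fbasis x y) * (d *: fbasis y' z) = 0.
Proof.
by move=> ne; apply: etrans (B0_mulZ _ _ _ _) _; rewrite B0_deltaM0 // scaler0.
Qed.

Lemma path_valueM (p q : path) : pend p = pstart q ->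
  path_value (pcat p q) = path_value p * path_value q.
Proof.
move=> e; rewrite /path_value /word_value pstart_pcat // pend_pcat // e.
suff W : wmon (pstart p) (pend q) (path_word (pcat p q)) =
    wmon (pstart p) (pstart q) (path_word p) * wmon (pstart q) (pend q) (path_word q)
    * Umon (pstart p) (pstart q) (pend q).
  by rewrite W; exact: esym (fbasisZM _ _ _ _ _).
have -> : path_word (pcat p q) = FMonom (path_word p ++ path_word q).
  by rewrite /path_word /= -map_cat /parrows val_pcat.
rewrite /wmon /Umon -!big_split /=; apply: eq_bigr => i _; rewrite -!exprD.
(* Once doubled, all exponents satisfy exact linear identities, and the claim reduces to additivity
   of [wcost]. *)
congr (_ ^+ _); apply: double_inj; rewrite !doubleD.
have := wexp_path p i; have := wexp_path q i; have := wexp_path (pcat p q) i.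
rewrite pstart_pcat // pend_pcat // e.
have -> : path_word (pcat p q) = FMonom (path_word p ++ path_word q).
  by rewrite /path_word /= -map_cat /parrows val_pcat.
rewrite /= wcost_cat; have := Uexp_double (pstart p) (pstart q) (pend q) i; lia.
Qed.

Definition to_B0 : PA -> B0F2 := linext path_value.

Lemma to_B0_delta p : to_B0 (delta p) = path_value p.
Proof. exact: linext_delta. Qed.

Lemma to_B0D a b : to_B0 (a + b) = to_B0 a + to_B0 b.
Proof. exact: linextD. Qed.

Lemma to_B0Z (c : 'F_2) a : to_B0 (c *: a) = c *: to_B0 a.
Proof. exact: linextZ. Qed.

Lemma to_B0_is_zmod_morphism : zmod_morphism to_B0.
Proof. by move=> a b; rewrite /to_B0 -scaleN1r linextD linextZ scaleN1r. Qed.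

HB.instance Definition _ := GRing.isZmodMorphism.Build PA B0F2
  to_B0 to_B0_is_zmod_morphism.

Lemma path_value_vert x : path_value (pvert (x : vert (Gamma n k))) = fbasis x x.
Proof.
rewrite /path_value /word_value /= /wmon big1 ?scale1r // => i _.
by rewrite /wexp /wcost big_nil sub0n.
Qed.

Lemma to_B0_is_monoid_morphism : monoid_morphism to_B0.
Proof.
split=> [|a b].
  by rewrite raddf_sum; apply: eq_bigr => x _;
    exact: etrans (to_B0_delta _) (path_value_vert x).
elim/malg_ind: a => [|a1 a2 I1 I2|c p]; first by rewrite mul0r raddf0 mul0r.
  rewrite mulrDl (to_B0D ((a1 : PA) * b) ((a2 : PA) * b)) (to_B0D a1 a2) [RHS]mulrDl.
  exact: (congr2 +%R I1 I2).
elim/malg_ind: b => [|b1 b2 I1 I2|d q]; first by rewrite mulr0 raddf0 mulr0.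
  set u : PA := c *: _; rewrite mulrDr (to_B0D (u * b1) (u * b2)).
  rewrite (to_B0D b1 b2) [RHS]mulrDr.
  exact: (congr2 +%R I1 I2).
rewrite (path_algebra_mulZ c d (delta p) (delta q)).
have E (e : 'F_2) r : to_B0 (e *: delta r) = e *: path_value r.
  by apply: etrans (to_B0Z _ _) _; rewrite to_B0_delta.
have F : to_B0 ((delta p : PA) * (delta q : PA)) = path_value p * path_value q.
  have [e|ne] := eqVneq (pend p) (pstart q).
    by rewrite (path_algebra_mulU e) to_B0_delta path_valueM.
  by rewrite (path_algebra_mulU0 ne) raddf0; exact: esym (fbasisZM0 _ _ _ _ ne).
have G := to_B0Z (c * d) ((delta p : PA) * (delta q : PA)).
rewrite F in G; apply: etrans G _.
have H := congr2 (fun u v : B0F2 => u * v) (E c p) (E d q).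
apply: etrans _ (esym H).
exact: esym (B0F2_mulZ c d (path_value p) (path_value q)).
Qed.

HB.instance Definition _ := GRing.isMonoidMorphism.Build PA B0F2
  to_B0 to_B0_is_monoid_morphism.

Lemma word_value_eq x y (u v : {fmonom (label n)}) : wcost u =1 wcost v ->
  word_value x y u = word_value x y v.
Proof.
move=> e; suff W : wmon x y u = wmon x y v by rewrite /word_value W.
by apply: eq_bigr => i _; rewrite /wexp e.
Qed.

(** In each relation the two monomials have equal cost at every index: they are rearrangements of
    each other, or an R and an L of cost 1 against a U of cost 2. *)
Lemma rel_value x y (r : nc_poly n) : rel_expr r -> linext (word_value x y) r = 0.
Proof.
have E (u v : seq (label n)) : wcost u =1 wcost v ->
    linext (word_value x y) (delta (FMonom u) - delta (FMonom v)) = 0.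
  move=> e; rewrite -scaleN1r linextD linextZ !linext_delta scaleN1r.
  by rewrite (@word_value_eq x y (FMonom u) (FMonom v)) ?subrr.
by case=> [i j|i j|i j|i|i|i j _|i j _|i j _]; rewrite ?nc_varM; apply: E => a;
  rewrite /wcost !big_cons !big_nil /cost /= ?addn0 1?addnC //; case: (_ == _).
Qed.

Lemma to_B0_rel a : relations a -> to_B0 a = 0.
Proof.
case=> x [y [ends r]]; rewrite -(rel_value x y r) /label_expr.
(* All paths in [a] share their ends, so its value depends only on [label_expr a]. *)
have -> : to_B0 a = linext (fun p => word_value x y (path_word p)) a.
  by apply: eq_big_seq => p /ends[<- <-].
elim/malg_ind: {ends r} a => [|a1 a2 I1 I2|c p]; first by rewrite !linext0.
  by rewrite !linextD I1 I2.
by rewrite !linextZ !linext_delta.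
Qed.

Definition quiv_to_B0 : Quiv n k -> B0 n k := quot_lift to_B0.

Lemma quiv_to_B0_is_zmod_morphism : zmod_morphism quiv_to_B0.
Proof. exact: quot_lift_is_zmod_morphism to_B0_rel. Qed.

Lemma quiv_to_B0_is_monoid_morphism : monoid_morphism quiv_to_B0.
Proof. exact: quot_lift_is_monoid_morphism to_B0_rel. Qed.

HB.instance Definition _ := GRing.isZmodMorphism.Build (Quiv n k) (B0 n k)
  quiv_to_B0 quiv_to_B0_is_zmod_morphism.
HB.instance Definition _ := GRing.isMonoidMorphism.Build (Quiv n k) (B0 n k)
  quiv_to_B0 quiv_to_B0_is_monoid_morphism.

Lemma quiv_to_B0_delta (p : path) : quiv_to_B0 (pi (delta p)) = path_value p.
Proof. by rewrite -to_B0_delta; exact: quot_lift_pi to_B0_rel _. Qed.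

End ToB0.

(** * The inverse map and the isomorphism *)

Section Isomorphism.
Variables n k : nat.
Implicit Types (x y z : states n k) (l m : label n) (i j : 'I_n).
Local Notation arrow := (arrow n k).
Local Notation PA := (path_algebra (Gamma n k) 'F_2).
Local Notation pi := (@quot_pi PA (@relations n k)).
Local Notation path := (qpath (Gamma n k)).

Definition from_B0 (v : B0 n k) : Quiv n k :=
  \sum_(p : states n k * states n k) pi_eval p.1 v@_p * gclass p.1 p.2.

Lemma from_B0_is_zmod_morphism : zmod_morphism from_B0.
Proof.
move=> u v; rewrite /from_B0 -sumrB; apply: eq_bigr => p _.
by rewrite mcoeffB raddfB mulrBl.
Qed.

HB.instance Definition _ := GRing.isZmodMorphism.Build (B0 n k) (Quiv n k)
  from_B0 from_B0_is_zmod_morphism.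

Lemma from_B0_fbasis c x y : from_B0 (c *: fbasis x y) = pi_eval x c * gclass x y.
Proof.
rewrite /from_B0 (bigD1 (x, y)) //= big1 => [|p ne].
  by rewrite addr0 mcoeffZ /fbasis deltaE mcoeffUU mulr1.
rewrite mcoeffZ /fbasis deltaE mcoeffU eq_sym (negPf ne) mulr0n mulr0 raddf0.
exact: mul0r.
Qed.

Definition arrow_weight l : Upoly n :=
  if lsgn l == 0 then Uvar (lidx l) else 1.

Lemma path_value_arrow x l y (h : is_arrow x l y) :
  path_value (parrow (arrow_of h : arr (Gamma n k))) = arrow_weight l *: fbasis x y.
Proof.
suff W : wmon x y [:: l] = arrow_weight l by rewrite -W.
rewrite /wmon (bigD1 (lidx l)) //= big1 ?mulr1 => [|i ne]; last first.
  by rewrite /wexp /wcost big_seq1 /cost (negPf ne) sub0n.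
rewrite /wexp /wcost big_seq1 /cost /absv (vdiff_arrow _ h) eqxx /arrow_weight.
by case: (l).
Qed.

(** Multiplicativity of [from_B0] for a left factor that is an arrow; this suffices to treat paths
    by induction. *)
Lemma from_B0_arrow x l y (h : is_arrow x l y) c z :
  from_B0 ((arrow_weight l *: fbasis x y) * (c *: fbasis y z)) =
  aclass (arrow_of h) * from_B0 (c *: fbasis y z).
Proof.
have -> := fbasisZM (arrow_weight l) c x y z.
have -> : arrow_weight l * c * Umon x y z = c * (arrow_weight l * Umon x y z).
  by rewrite mulrAC mulrC.
apply: etrans (from_B0_fbasis _ x z) _.
apply: etrans _
  (congr1 (fun u => aclass (arrow_of h) * u) (esym (from_B0_fbasis c y z))).
apply: etrans (congr1 (fun u => u * gclass x z) (pi_evalM x c _)) _.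
apply: etrans _ (esym (mulrA _ _ _)).
apply: etrans _ (congr1 (fun u => u * gclass y z) (esym (aclass_eval h c))).
apply: etrans (esym (mulrA _ _ _)) _; apply: etrans _ (mulrA _ _ _).
apply: (congr1 (fun u => pi_eval x c * u)); symmetry.
(* With the coefficient [c] moved to the front by [aclass_eval], what remains is [aclass_gclass] for
   an R or L; a loop has equal ends and acts as its variable. *)
rewrite /arrow_weight; case: eqP => [l0|/eqP l0]; last first.
  by rewrite mul1r; exact: aclass_gclass.
case: l h l0 => // i h _; have := h; rewrite /= => /eqP e; subst y.
rewrite Umon_xxy mulr1 pi_eval_loop ploopE.
by rewrite (bool_irrelevance (is_arrow_loop x i) h).
Qed.

Definition path_of x (s : seq arrow) (ws : @walk (Gamma n k) x s) : path :=
  exist (fun p => @walk (Gamma n k) p.1 p.2) (x, s) ws.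

Lemma from_B0_path (p : path) : from_B0 (path_value p) = pi (delta p).
Proof.
case: p => -[x s] ws; rewrite -/(path_of ws).
elim: s x ws => [|[[[x' l] y] h] s IH] x ws.
  have -> : path_of ws = pvert (x : vert (Gamma n k)) by apply: val_inj.
  rewrite path_value_vert -[fbasis x x]scale1r from_B0_fbasis pi_eval1 gclass_refl.
  by rewrite -rmorphM pidem_idem.
have /andP[/eqP ex ws'] := ws; rewrite /= /arrow_src /= in ex; subst x'.
pose a := parrow (arrow_of h : arr (Gamma n k)).
pose q := path_of ws'.
have e : pend a = pstart q by [].
have -> : path_of ws = pcat a q by apply: val_inj; rewrite val_pcat.
rewrite path_valueM // path_value_arrow -(path_algebra_mulU e) rmorphM.
have Eq : from_B0 (path_value q) = pi (delta q) := IH y ws'.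
rewrite -[X in _ = _ * X]Eq.
exact: (from_B0_arrow h (wmon (pstart q) (pend q) (path_word q)) (pend q)).
Qed.

Lemma quiv_to_B0K : cancel (@quiv_to_B0 n k) from_B0.
Proof.
move=> u; have [a ->] := quot_surj u.
elim/malg_ind: a => [|a b Ia Ib|c p]; first by rewrite !raddf0.
  by rewrite !raddfD; apply: congr2.
(* Both maps are used here only as additive maps, so the scalar is treated as 0 or 1. *)
have : c \in [:: 0; 1 : 'F_2] by case: c => -[|[|]].
rewrite !inE => /orP[] /eqP ->; first by rewrite scale0r !raddf0.
by rewrite scale1r quiv_to_B0_delta from_B0_path.
Qed.

Lemma quiv_to_B0_eval x p : quiv_to_B0 (pi_eval x p) = p *: fbasis x x.
Proof.
pose P (r : Upoly n) := quiv_to_B0 (pi_eval x r) = r *: fbasis x x.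
have P1 : P 1.
  rewrite /P pi_eval1; apply: etrans (quiv_to_B0_delta _) _.
  by rewrite path_value_vert scale1r.
have PM q r : P q -> P r -> P (q * r).
  move=> Pq Pr; rewrite /P pi_evalM rmorphM.
  apply: etrans (congr2 (fun u v : B0 n k => u * v) Pq Pr) _.
  have W : q * r * Umon x x x = q * r by rewrite Umon_xxy mulr1.
  by have E := fbasisZM q r x x x; rewrite W in E; exact E.
elim/Upoly_ind: p => [|p q Ip Iq|m]; first by rewrite !raddf0 scale0r.
  rewrite pi_evalD; apply: etrans (raddfD _ _ _) _.
  apply: etrans (congr2 (fun u v : B0 n k => u + v) Ip Iq) _.
  exact: esym (scalerDl (fbasis x x) p q).
(* Since [P] is closed under products, single variables, that is loops, are enough. *)
have -> : mpolyX 'F_2 m = \prod_(i < n) Uvar i ^+ m i by exact: mpolyXE_id.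
apply: (big_ind P P1 PM) => i _.
elim: (m i) => [|e IH]; first by rewrite expr0.
rewrite exprS; apply: PM IH; rewrite /P pi_eval_loop ploopE.
apply: etrans (quiv_to_B0_delta _) _.
exact: (path_value_arrow (is_arrow_loop x i)).
Qed.

(** Every step is good, so by [Umon_arrow] no power of U appears. *)
Lemma quiv_to_B0_geodesic x z s : geodesic z x s ->
  quiv_to_B0 (arrows_class z s) = fbasis x z.
Proof.
elim: s x => [|[[[x' l] y] h] s IH] x /=.
  by move=> /eqP ->; rewrite quiv_to_B0_delta path_value_vert.
rewrite /arrow_src /arrow_label /arrow_tgt /= in h *.
move=> /and3P[/eqP <- g /IH E]; apply: etrans (rmorphM _ _ _) _.
apply: etrans (congr2 (fun u v : B0 n k => u * v) (quiv_to_B0_delta _) E) _.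
rewrite (path_value_arrow h) /arrow_weight (negPf (good_move g)) scale1r.
apply: etrans (fbasisM _ _ _) _.
by rewrite (Umon_arrow z h (good_move g)) g scale1r.
Qed.

Lemma from_B0K : cancel from_B0 (@quiv_to_B0 n k).
Proof.
move=> v; elim/malg_ind: v => [|u v Iu Iv|c [x z]]; first by rewrite !raddf0.
  by rewrite !raddfD; apply: congr2.
rewrite (from_B0_fbasis c x z); apply: etrans (rmorphM _ _ _) _.
apply: etrans (congr2 (fun u v : B0 n k => u * v) (quiv_to_B0_eval x c)
  (quiv_to_B0_geodesic (xchooseP (geodesic_exists x z)))) _.
have E := fbasisZM c 1 x x z; rewrite Umon_xxy !mulr1 in E.
by apply: etrans E; rewrite scale1r.
Qed.

(** Inherited from [quiv_to_B0], a multiplicative bijection with inverse [from_B0]. *)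
Lemma from_B0_is_monoid_morphism : monoid_morphism from_B0.
Proof.
have inj := can_inj quiv_to_B0K.
split=> [|u v]; apply: inj.
  exact: etrans (from_B0K 1) (esym (rmorph1 (@quiv_to_B0 n k))).
apply: etrans (from_B0K _) _.
apply: etrans _ (esym (rmorphM (@quiv_to_B0 n k) _ _)).
exact: (congr2 (fun u v : B0 n k => u * v) (esym (from_B0K u)) (esym (from_B0K v))).
Qed.

HB.instance Definition _ := GRing.isMonoidMorphism.Build (B0 n k) (Quiv n k)
  from_B0 from_B0_is_monoid_morphism.

Lemma from_B0_unit f : from_B0 (B0_unit f) = Quiv_unit f.
Proof.
rewrite Quiv_unitE /B0_unit raddf_sum; apply: eq_bigr => x _.
apply: etrans (from_B0_fbasis (f x) x x) _.
by rewrite gclass_refl -pi_eval1 -pi_evalM mulr1.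
Qed.

End Isomorphism.

Theorem theorem1p1 (n k : nat) (hk : (k <= n.+1)%N) :
  isomorphic_over (@B0_unit n k) (@Quiv_unit n k).
Proof.
exists (@from_B0 n k); split; last exact: from_B0_unit.
exact: Bijective (@from_B0K n k) (@quiv_to_B0K n k).
Qed.
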